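(* There exists an oracle $O \subseteq \mathbb{N}$ such that the following two statements hold simultaneously: (1) $\mathrm{NP}^O \cap \mathrm{coNP}^O$ does not contain a problem that is complete for $\mathrm{NP}^O\cap\mathrm{coNP}^O$ under polynomial-time many-one reductions computable with oracle $O$ (i.e. there is no $C \in \mathrm{NP}^O\cap\mathrm{coNP}^O$ with $A \le_m^{p,O} C$ for all $A\in \mathrm{NP}^O\cap\mathrm{coNP}^O$); (2) the set $\overline{K^O}$ has a $\mathrm{P}^O$-optimal proof system.
   Context: Let $\Sigma=\{0,1\}$; words in $\Sigma^*$ are identified with natural numbers via the polynomial-time computable and invertible bijection $w \mapsto \sum_{i<|w|}(1+w(i))2^{|w|-1-i}$, and $|n|$ denotes the length of $n$. Let $\langle\cdot\rangle:\bigcup_{i\ge0}\mathbb{N}^i\to\mathbb{N}$ be an injective, polynomial-time computable and invertible pairing function with $|\langle u_1,\dots,u_n\rangle| = 2(|u_1|+\dots+|u_n|+n)$. Let $M_1,M_2,\dots$ be a fixed standard enumeration of nondeterministic polynomial-time oracle Turing machines: for every oracle $D$ and input $x$, $M_i^D(x)$ stops within $|x|^i+i$ steps; every nondeterministic polynomial-time oracle machine is equivalent (for all oracles) to infinitely many $M_i$; and there is a nondeterministic polynomial-time oracle machine that on input $\langle i,x,0^{|x|^i+i}\rangle$ simulates $M_i^D(x)$. For an oracle $D$, $K^D = \{\langle 0^i,0^t,x\rangle : i\ge1,\ t,x\in\mathbb{N},\ M_i^D(x) \text{ accepts within } t \text{ steps}\}$; it is $\mathrm{NP}^D$-complete and $\overline{K^D}$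 (complement in $\Sigma^*$) is $\mathrm{coNP}^D$-complete. For sets $A,B$, $A\le_m^{p,D} B$ means there is $f\in \mathrm{FP}^D$ with $x\in A \Leftrightarrow f(x)\in B$ for all $x$. A proof system (relative to $D$) for a set $S$ is a function $f\in\mathrm{FP}^D$ with range exactly $S$. For $f,g\in\mathrm{FP}^D$, $f\le^{p,D} g$ ($g$ $\mathrm{P}^D$-simulates $f$) if there is $\pi\in\mathrm{FP}^D$ with $g(\pi(x))=f(x)$ for all $x$. A proof system $g$ for $S$ is $\mathrm{P}^D$-optimal if $f\le^{p,D} g$ for every proof system $f\in\mathrm{FP}^D$ with range $S$. *)

(* Defs.v *)
From mathcomp Require Import all_boot.
Set Implicit Arguments. Unset Strict Implicit. Unset Printing Implicit Defensive.

Definition word := seq bool.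

(* w |-> sum_{i<|w|} (1 + w(i)) 2^{|w|-1-i}  (bijective base-2 numeration) *)
Definition nat_of_word (w : word) : nat :=
  foldl (fun acc (b : bool) => 2 * acc + (1 + b)) 0 w.

Definition zeros (n : nat) : word := nseq n false.

(** Pairing: every bit b is doubled (bb) and every component is terminated by
    the separator 01, so |<u_1,...,u_n>| = 2(|u_1|+...+|u_n|+n). *)
Definition pairing (us : seq word) : word :=
  flatten [seq flatten [seq [:: b; b] | b <- u] ++ [:: false; true] | u <- us].

(** * Oracle Turing machines
    One two-way infinite work tape over {0,1,blank} (blank = None), holding
    the input initially, plus a write-only query string; in the query state
    the oracle is asked about the query string, which is then erased, and the
    machine moves to the yes/no state.  Nondeterminism: several transitions
    may apply.  The accepting state is halting. *)
Definition sym := option bool.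

Inductive move := MoveL | MoveR | Stay.

Record tape := Tape { lft : seq sym; cur : sym; rgt : seq sym }.

Definition move_tape (m : move) (t : tape) : tape :=
  match m with
  | MoveL => match lft t with
             | [::] => Tape [::] None (cur t :: rgt t)
             | a :: l => Tape l a (cur t :: rgt t)
             end
  | MoveR => match rgt t with
             | [::] => Tape (cur t :: lft t) None [::]
             | a :: r => Tape (cur t :: lft t) a r
             end
  | Stay => t
  end.

Definition write_tape (s : sym) (t : tape) : tape := Tape (lft t) s (rgt t).

Record trans := Trans {
  t_from : nat; t_read : sym; t_write : sym; t_move : move;
  t_query : option bool; (* optionally append a bit to the query string *)
  t_to : nat }.

Record machine := Machine {
  m_trans : seq trans; m_start : nat;
  m_qask : nat; m_qyes : nat; m_qno : nat; m_qacc : nat }.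

Record config := Config { c_state : nat; c_tape : tape; c_query : word }.

Fixpoint mem_list {T : Type} (x : T) (s : seq T) : Prop :=
  match s with [::] => False | y :: s' => y = x \/ mem_list x s' end.

Definition oracle := word -> Prop.

Definition step (D : oracle) (M : machine) (c c' : config) : Prop :=
  (c_state c = m_qask M /\ c_tape c' = c_tape c /\ c_query c' = [::] /\
     ((D (c_query c) /\ c_state c' = m_qyes M) \/
      (~ D (c_query c) /\ c_state c' = m_qno M)))
  \/
  (c_state c <> m_qask M /\ c_state c <> m_qacc M /\
   exists tr, mem_list tr (m_trans M) /\ t_from tr = c_state c /\
     t_read tr = cur (c_tape c) /\ c_state c' = t_to tr /\
     c_tape c' = move_tape (t_move tr) (write_tape (t_write tr) (c_tape c)) /\
     c_query c' = (match t_query tr with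
                   | Some b => rcons (c_query c) b
                   | None => c_query c end)).

Fixpoint steps (D : oracle) (M : machine) (n : nat) (c c' : config) : Prop :=
  match n with
  | 0 => c = c'
  | n'.+1 => exists c'', step D M c c'' /\ steps D M n' c'' c'
  end.

Definition tape_of (x : word) : tape :=
  match x with
  | [::] => Tape [::] None [::]
  | b :: w => Tape [::] (Some b) (map Some w)
  end.

Definition init (M : machine) (x : word) : config := Config (m_start M) (tape_of x) [::].

Definition accepts_within (D : oracle) (M : machine) (x : word) (t : nat) : Prop :=
  exists n c, n <= t /\ steps D M n (init M x) c /\ c_state c = m_qacc M.

Definition accepts (D : oracle) (M : machine) (x : word) : Prop :=
  exists t, accepts_within D M x t.

Definition halts_within (D : oracle) (M : machine) (x : word) (t : nat) : Prop :=
  forall c, ~ steps D M t.+1 (init M x) c.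

Definition ptime (M : machine) (k : nat) : Prop :=
  forall D x, halts_within D M x (size x ^ k + k).

Definition deterministic (M : machine) : Prop :=
  forall D c c1 c2, step D M c c1 -> step D M c c2 -> c1 = c2.

Fixpoint takebits (s : seq sym) : word :=
  match s with
  | Some b :: s' => b :: takebits s'
  | _ => [::]
  end.

Definition output (t : tape) : word := takebits (cur t :: rgt t).

Definition computes (D : oracle) (M : machine) (x y : word) : Prop :=
  exists n c, steps D M n (init M x) c /\ (forall c', ~ step D M c c') /\
              y = output (c_tape c).

Definition language := word -> Prop.

Definition NP (D : oracle) (L : language) : Prop :=
  exists M k, ptime M k /\ forall x, L x <-> accepts D M x.

Definition coNP (D : oracle) (L : language) : Prop :=
  NP D (fun x => ~ L x).

Definition FP (D : oracle) (f : word -> word) : Prop :=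
  exists M k, deterministic M /\ ptime M k /\ forall x, computes D M x (f x).

Definition mreduces (D : oracle) (A B : language) : Prop :=
  exists f, FP D f /\ forall x, A x <-> B (f x).

Definition proof_system (D : oracle) (S : language) (f : word -> word) : Prop :=
  FP D f /\ forall y, S y <-> exists x, f x = y.

Definition psim (D : oracle) (f g : word -> word) : Prop :=
  exists pi, FP D pi /\ forall x, g (pi x) = f x.

Definition P_optimal (D : oracle) (S : language) (g : word -> word) : Prop :=
  proof_system D S g /\ forall f, proof_system D S f -> psim D f g.

Definition standard_enum (Menum : nat -> machine) : Prop :=
  (forall i, 1 <= i -> ptime (Menum i) i) /\
  (forall M k, ptime M k -> forall n, exists i, n <= i /\ 1 <= i /\
       forall D x, accepts D (Menum i) x <-> accepts D M x) /\
  (exists U k, ptime U k /\ forall D i wi x, 1 <= i -> nat_of_word wi = i ->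
       (accepts D U (pairing [:: wi; x; zeros (size x ^ i + i)]) <->
        accepts D (Menum i) x)).

Definition K (Menum : nat -> machine) (D : oracle) : language :=
  fun w => exists i t x, 1 <= i /\ w = pairing [:: zeros i; zeros t; x] /\
                         accepts_within D (Menum i) x t.

Definition coK (Menum : nat -> machine) (D : oracle) : language :=
  fun w => ~ K Menum D w.

(* Main.v *)
Require Import Defs.
From mathcomp Require Import all_boot zify.
From Stdlib Require Import Classical ClassicalEpsilon FunctionalExtensionality.
Set Implicit Arguments. Unset Strict Implicit. Unset Printing Implicit Defensive.

(** The oracle is built in stages. A trusted deterministic machine [M] gets a tag
    [e], and the oracle spells, bit by bit, the output of [M] on [x] as the value of
    the padded word [0^e 1 x 1 0^m]; a fixed machine, the decoder, reads these bits
    and is the optimal proof system. [M] becomes trusted only if no oracle compatible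
    with the commitments made so far makes it output an element of [K]; otherwise such
    an oracle is frozen up to some length, and [M] is not a proof system for the
    complement of [K]. A separate tag with exponentially long padding makes the
    decoder surjective.

    A pair [(Ma, Mb)] of nondeterministic machines becomes active only if, for every
    compatible oracle, [Ma] or [Mb] accepts each input; from then on exactly one of
    the regions [0^p 1 b {0,1}^n 1], for [b = 0, 1], meets the oracle, for each [n].
    To refute a reduction [M] of the resulting language to that of [Ma], leave the
    region of one large length [n] empty. The codes of later trusted machines are
    sound even for that oracle, since an error would survive the addition of a
    suitable string; hence the oracle is compatible with the commitments at the time
    the pair became active, and one of [Ma], [Mb] accepts the output of [M] on [0^n].
    Because of the padding a code of length [l] depends on at most [l] strings of the
    region, so some string with the wrong [b] can be added without affecting this. *)

(** * Locality of computations *)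

Definition agree (L : nat) (D D' : oracle) :=
  forall q, size q < L -> (D q <-> D' q).

(** One bound [b] limits both the number and the length of the relevant queries: the length gives
    agreement of oracles below [b], the number feeds the counting of sensitive strings. *)
Definition certified (b : nat) (Q : oracle -> Prop) (D : oracle) :=
  exists qs : seq word, [/\ size qs <= b, forall q, q \in qs -> size q < b &
    forall D', (forall q, q \in qs -> (D q <-> D' q)) -> Q D'].

Lemma certified_agree b Q D D' : certified b Q D -> agree b D D' -> Q D'.
Proof. by case=> qs [_ lt_b HQ] DD'; apply: HQ => q /lt_b; apply: DD'. Qed.

Lemma agreeS L D D' : agree L D D' -> agree L D' D.
Proof. by move=> DD' q /DD' H; split=> /H. Qed.

Lemma agreeW L L' D D' : L' <= L -> agree L D D' -> agree L' D D'.
Proof. by move=> le_L DD' q lt_q; apply: DD'; apply: leq_trans le_L. Qed.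

Lemma agree_trans L D1 D2 D3 : agree L D1 D2 -> agree L D2 D3 -> agree L D1 D3.
Proof. by move=> H1 H2 q lt_q; split=> [/(H1 q lt_q)/(H2 q lt_q)|/(H2 q lt_q)/(H1 q lt_q)]. Qed.

Lemma steps_cat D M n1 n2 c1 c2 c3 :
  steps D M n1 c1 c2 -> steps D M n2 c2 c3 -> steps D M (n1 + n2) c1 c3.
Proof.
elim: n1 c1 => [|n IHn] c1 /=; first by move=> ->.
by case=> c [c1c cc2] c2c3; exists c; split=> //; apply: IHn.
Qed.

Lemma steps_split D M n1 n2 c1 c3 :
  steps D M (n1 + n2) c1 c3 -> exists2 c2, steps D M n1 c1 c2 & steps D M n2 c2 c3.
Proof.
elim: n1 c1 => [|n IHn] c1 /=; first by exists c1.
by case=> c [c1c /IHn[c2 cc2 c2c3]]; exists c2 => //; exists c.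
Qed.

Lemma step_query_size D M c c' : step D M c c' ->
  size (c_query c') <= (size (c_query c)).+1.
Proof.
case=> [[_ [_ [-> _]]]//|[_ [_ [tr [_ [_ [_ [_ [_ ->]]]]]]]]].
by case: (t_query tr) => // b; rewrite size_rcons.
Qed.

Lemma step_local D D' M c c' : step D M c c' ->
  (c_state c = m_qask M -> (D (c_query c) <-> D' (c_query c))) -> step D' M c c'.
Proof.
case=> [[sc [tc [qc DD']]]|nask] H; last by right.
by left; split=> //; split=> //; split=> //; have := H sc; tauto.
Qed.

Lemma steps_local D M n c c' : steps D M n c c' ->
  exists qs : seq word, [/\ size qs <= n,
    forall q, q \in qs -> size q < size (c_query c) + n &
    forall D', (forall q, q \in qs -> (D q <-> D' q)) -> steps D' M n c c'].
Proof.
elim: n c => [|n IHn] c /=; first by move=> ->; exists [::].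
case=> c1 [cc1 /IHn[qs [le_qs lt_q Hqs]]].
have le_c1 := step_query_size cc1.
(* The current query string is listed whether or not this step asks it, so every step costs exactly
   one entry. *)
exists (c_query c :: qs); split=> //.
  move=> q; rewrite inE => /orP[/eqP-> | /lt_q lt_qn]; first by rewrite addnS ltnS leq_addr.
    by rewrite addnS -addSn; apply: leq_trans lt_qn _; rewrite leq_add2r.
move=> D' DD'; exists c1; split; last first.
  by apply: Hqs => q qs_q; apply: DD'; rewrite inE qs_q orbT.
by apply: step_local cc1 _ => _; apply: DD'; rewrite inE eqxx.
Qed.

(** In the query state some successor exists whatever the answer is; a halted configuration is
    therefore not in that state, and no other step consults the oracle. *)
Lemma halted_indep D D' M c :
  (forall c', ~ step D M c c') -> forall c', ~ step D' M c c'.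
Proof.
move=> haltc c' cc'; have [ask_c|nask] := eqVneq (c_state c) (m_qask M).
  have [Dq|nDq] := classic (D (c_query c)).
    by apply: (haltc (Config (m_qyes M) (c_tape c) [::])); left; do !split=> //; left.
  by apply: (haltc (Config (m_qno M) (c_tape c) [::])); left; do !split=> //; right.
by apply: (haltc c'); apply: step_local cc' _ => ask_c; rewrite ask_c eqxx in nask.
Qed.

Lemma ptime_steps M k D x n c : ptime M k -> steps D M n (init M x) c ->
  n <= size x ^ k + k.
Proof.
move=> pM Hn; rewrite leqNgt; apply/negP => lt_n.
rewrite -(subnKC lt_n) in Hn; case: (steps_split Hn) => c2 H2 _.
exact: (pM D x c2 H2).
Qed.

Lemma computes_total M k D x : ptime M k -> exists y, computes D M x y.
Proof.
move=> pM; apply: NNPP => none.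
suff H n : exists c, steps D M n (init M x) c.
  by have [c /(ptime_steps pM)] := H (size x ^ k + k).+1; rewrite ltnn.
elim: n => [|n [c Hc]]; first by exists (init M x).
have [[c' cc']|nostep] := classic (exists c', step D M c c').
  by exists c'; rewrite -addn1; apply: steps_cat Hc _; exists c'.
case: none; exists (output (c_tape c)), n, c; do !split=> //.
by move=> c' cc'; apply: nostep; exists c'.
Qed.

Lemma steps_det D M n c c1 c2 : deterministic M ->
  steps D M n c c1 -> steps D M n c c2 -> c1 = c2.
Proof.
move=> dM; elim: n c => [|n IHn] c /=; first by move=> <- <-.
by case=> a [ca aH] [b [cb bH]]; rewrite (dM _ _ _ _ ca cb) in aH; apply: IHn aH bH.
Qed.

Lemma steps_halted D M n m c c1 c2 : deterministic M ->
  steps D M n c c1 -> (forall c', ~ step D M c1 c') -> steps D M m c c2 -> m <= n.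
Proof.
move=> dM Hn halt1 Hm; rewrite leqNgt; apply/negP => lt_nm.
rewrite -(subnKC lt_nm) addSnnS in Hm; case: (steps_split Hm) => c3 H3 /= [c' [c3c' _]].
by rewrite -(steps_det dM Hn H3) in c3c'; apply: halt1 c3c'.
Qed.

Lemma computes_inj D M x y1 y2 : deterministic M ->
  computes D M x y1 -> computes D M x y2 -> y1 = y2.
Proof.
move=> dM [n1 [c1 [H1 [h1 ->]]]] [n2 [c2 [H2 [h2 ->]]]].
have le12 := steps_halted dM H2 h2 H1; have le21 := steps_halted dM H1 h1 H2.
have eq_n : n1 = n2 by lia.
by rewrite eq_n in H1; rewrite (steps_det dM H1 H2).
Qed.

Lemma size_takebits s : size (takebits s) <= size s.
Proof. by elim: s => //= -[b|] s IHs. Qed.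

Lemma step_tape_size D M c c' : step D M c c' ->
  size (rgt (c_tape c')) <= (size (rgt (c_tape c))).+1.
Proof.
case=> [[_ [-> _]]//|[_ [_ [tr [_ [_ [_ [_ [-> _]]]]]]]]].
by case: (t_move tr); case: (c_tape c) => l s [|a r] //; case: l => //=; lia.
Qed.

Lemma steps_tape_size D M n c c' : steps D M n c c' ->
  size (rgt (c_tape c')) <= size (rgt (c_tape c)) + n.
Proof.
elim: n c => [|n IHn] c /=; first by move=> ->; rewrite addn0.
by case=> c1 [/step_tape_size le1 /IHn]; lia.
Qed.

Lemma computes_size M k D x y : ptime M k -> computes D M x y ->
  size y < size x + (size x ^ k + k) + 2.
Proof.
move=> pM [n [c [Hn [_ ->]]]].
have le_n := ptime_steps pM Hn; have le_r := steps_tape_size Hn.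
have := size_takebits (cur (c_tape c) :: rgt (c_tape c)); rewrite /output /=.
by move: le_r; case: x {pM Hn} le_n => [|b x] /=; rewrite ?size_map; lia.
Qed.

Lemma computes_certified M k D x y : ptime M k -> computes D M x y ->
  certified (size x ^ k + k) (fun D' => computes D' M x y) D.
Proof.
move=> pM [n [c [Hn [hc y_def]]]]; have le_n := ptime_steps pM Hn.
have [qs [le_qs lt_q Hqs]] := steps_local Hn.
exists qs; split; first exact: leq_trans le_n.
  by move=> q /lt_q /=; lia.
by move=> D' DD'; exists n, c; split; [exact: Hqs | split=> //; exact: halted_indep hc].
Qed.

Lemma accepts_certified M k D x : ptime M k -> accepts D M x ->
  certified (size x ^ k + k) (fun D' => accepts D' M x) D.
Proof.
move=> pM [t [n [c [_ [Hn acc_c]]]]]; have le_n := ptime_steps pM Hn.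
have [qs [le_qs lt_q Hqs]] := steps_local Hn.
exists qs; split; first exact: leq_trans le_n.
  by move=> q /lt_q /=; lia.
by move=> D' DD'; exists n, n, c; split=> //; split=> //; exact: Hqs.
Qed.

Lemma accepts_agree M k D D' x : ptime M k -> agree (size x ^ k + k) D D' ->
  (accepts D M x <-> accepts D' M x).
Proof.
move=> pM DD'; split=> acc; apply: certified_agree (accepts_certified pM acc) _ => //.
exact: agreeS.
Qed.

Lemma computes_agree M k D D' x y : ptime M k -> agree (size x ^ k + k) D D' ->
  (computes D M x y <-> computes D' M x y).
Proof.
move=> pM DD'; split=> acc; apply: certified_agree (computes_certified pM acc) _ => //.
exact: agreeS.
Qed.

(** * Locality of the complete set [K] *)

Section K.
Variable Menum : nat -> machine.

Lemma size_pairing us : size (pairing us) = \sum_(u <- us) (2 * size u + 2).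
Proof.
rewrite /pairing size_flatten /shape -map_comp sumnE big_map.
apply: eq_bigr => u _ /=; rewrite size_cat /= size_flatten /shape -map_comp.
by elim: u => //= b u; lia.
Qed.

(** The time bound is written in unary inside the instance, so an accepting run is shorter than [y]
    itself. *)
Lemma K_certified D y : K Menum D y -> certified (size y) (fun D' => K Menum D' y) D.
Proof.
case=> i [t [x [i_gt0 [-> [n [c [le_n [Hn acc_c]]]]]]]].
set y' := pairing _; have lt_t : t < size y'.
  by rewrite /y' size_pairing !big_cons /zeros !size_nseq; lia.
have [qs [le_qs lt_q Hqs]] := steps_local Hn.
exists qs; split; first lia.
  by move=> q /lt_q /=; lia.
move=> D' DD'; exists i, t, x; do 2!split=> //.
by exists n, c; split=> //; split=> //; exact: Hqs.
Qed.

Lemma K_agree D D' y : agree (size y) D D' -> (K Menum D y <-> K Menum D' y).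
Proof.
move=> DD'; split=> Ky; apply: certified_agree (K_certified Ky) _ => //.
exact: agreeS.
Qed.

(** This makes the empty word a sound default value for padded words to which no rule applies. *)
Lemma K_nil D : ~ K Menum D [::].
Proof.
by case=> i [t [x [_ [/(congr1 size) + _]]]]; rewrite size_pairing !big_cons /=; lia.
Qed.

End K.

(** * Codes and stages *)

(** The closing [true] separates the word from the zeros with which it gets padded. *)
Definition tagged_word (e : nat) (x : word) : word :=
  nseq e false ++ true :: rcons x true.

(* The bit string a code spells: reversed, so that it can be written from right
   to left, and padded to length [m] by a self-delimiting prefix [0..01]. *)
Definition enc (m : nat) (y : word) : word :=
  nseq (m - 1 - size y) false ++ true :: rev y.

(* Query for bit [j] of the value of the word [v ++ nseq m false]. *)
Definition code_query (v : word) (m j : nat) : word :=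
  nseq j true ++ false :: v ++ nseq (m - j) false.

(** The last bit [true] keeps these strings apart from code queries, which end in [false] as long as
    [j < m]. *)
Definition region (p : nat) (b : bool) (y : word) : word :=
  nseq p false ++ true :: b :: rcons y true.

(* The quadratic padding makes the number of strings on which a code query
   depends at most linear in its length. *)
Definition pad (k : nat) (x : word) : nat := (size x + (size x ^ k + k) + 2) ^ 2.

Lemma nseq_cons_inj b e e' s s' :
  nseq e b ++ ~~ b :: s = nseq e' b ++ ~~ b :: s' -> e = e' /\ s = s'.
Proof.
elim: e e' => [|e IHe] [|e'] /=.
- by case=> ->.
- by case: b.
- by case: b {IHe}.
- by case=> H; have [-> ->] := IHe _ H.
Qed.

Lemma tagged_word_inj e e' x x' :
  tagged_word e x = tagged_word e' x' -> e = e' /\ x = x'.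
Proof. by case/(@nseq_cons_inj false) => -> /rcons_inj[->]. Qed.

Lemma region_inj p p' b b' y y' :
  region p b y = region p' b' y' -> [/\ p = p', b = b' & y = y'].
Proof. by case/(@nseq_cons_inj false) => -> [-> /rcons_inj[->]]. Qed.

Lemma last_tagged_word e x : last true (tagged_word e x).
Proof. by rewrite /tagged_word last_cat /= last_rcons. Qed.

Lemma last_region p b y : last false (region p b y).
Proof. by rewrite /region last_cat /= last_rcons. Qed.

Lemma size_region p b y : size (region p b y) = p + 3 + size y.
Proof. by rewrite /region size_cat size_nseq /= size_rcons; lia. Qed.

Lemma last_code_query v m j : j < m -> last false (code_query v m j) = false.
Proof.
move=> lt_jm; rewrite /code_query last_cat /= last_cat.
case E: (m - j) => [|r]; first by lia.
by rewrite -addn1 nseqD last_cat.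
Qed.

Lemma size_code_query v m j : j < m -> size (code_query v m j) = size v + m + 1.
Proof. by move=> lt_jm; rewrite /code_query size_cat /= size_cat !size_nseq; lia. Qed.

Lemma find_trailing v r : last true v -> find id (rev (v ++ nseq r false)) = r.
Proof.
rewrite rev_cat rev_nseq; elim: r => [|r IHr] /=; last by move=> /IHr->.
by case/lastP: v => //= v b; rewrite last_rcons rev_rcons /= => ->.
Qed.

Lemma trailing_inj v v' r r' : last true v -> last true v' ->
  v ++ nseq r false = v' ++ nseq r' false -> v = v' /\ r = r'.
Proof.
move=> lv lv' E; have := find_trailing r lv; rewrite E find_trailing // => r_eq.
have sv : size v = size v' by move/(congr1 size): E; rewrite !size_cat !size_nseq; lia.
by move/eqP: E; rewrite eqseq_cat // => /andP[/eqP-> _].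
Qed.

Lemma trailing_decomp (w : word) : exists v m, last true v /\ w = v ++ nseq m false.
Proof.
elim/last_ind: w => [|w [] [v [m [lv ->]]]]; first by exists [::], 0.
  by exists (rcons (v ++ nseq m false) true), 0; rewrite last_rcons cats0.
by exists v, m.+1; split=> //; rewrite -cats1 -catA -addn1 nseqD.
Qed.

Lemma code_query_inj v v' m m' j j' : last true v -> last true v' -> j < m -> j' < m' ->
  code_query v m j = code_query v' m' j' -> [/\ v = v', m = m' & j = j'].
Proof.
move=> lv lv' lt_j lt_j' /(@nseq_cons_inj true)[<- /(trailing_inj lv lv')[-> eq_m]].
by split=> //; lia.
Qed.

(** A forcing condition: [base] counts only below length [frozen], while [trusted] and [active] are
    promises about longer strings. Each machine comes with the exponent of its time bound. *)
Record state := State {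
  frozen : nat; base : oracle;
  trusted : nat -> option (machine * nat);
  active : nat -> option (machine * nat * (machine * nat)) }.

Section Forcing.
Variable Menum : nat -> machine.
Notation K := (K Menum).

Implicit Types (D : oracle) (T : nat -> option (machine * nat)).

(** The bound on [m] makes all queries of [M] on [x] shorter than the queries that spell its output,
    so values can be defined by recursion on length. *)
Definition applies T v m M k x :=
  exists e, [/\ v = tagged_word e x, T e = Some (M, k) & pad k x <= m].

(* Tag 0 is reserved for a proof system with exponentially long proofs. *)
Definition slow D v m x := [/\ v = tagged_word 0 x, 2 ^ size x <= m & ~ K D x].

Definition value T D v m y :=
  [\/ exists M k x, applies T v m M k x /\ computes D M x y, slow D v m y |
     [/\ y = [::], forall M k x, ~ applies T v m M k x & forall x, ~ slow D v m x]].

Definition codes D v m y :=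
  forall j, j < m -> (D (code_query v m j) <-> nth false (enc m y) j).

(** The first clause ensures that [m] bits of [enc m y] determine [y]. If no trusted machine and no
    slow proof prescribes the value, any word outside [K] is allowed. *)
Definition correct T D v m y :=
  [/\ size y < m \/ y = [::], ~ K D y,
      forall M k x, applies T v m M k x -> computes D M x y &
      forall x, slow D v m x -> y = x].

Definition splits D p n := exists b,
  (exists2 y, size y = n & D (region p b y)) /\
  (forall y, size y = n -> ~ D (region p (~~ b) y)).

Definition valid s D L :=
  [/\ agree (frozen s) D (base s),
     forall v m, last true v -> size v + m + 1 < L ->
       exists y, correct (trusted s) D v m y /\ codes D v m y &
     forall p n, active s p <> None -> p + 3 + n < L -> splits D p n].

Definition sound M k D L := forall x y,
  pad k x <= L -> computes D M x y -> ~ K D y.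

Definition covers (a : machine * nat * (machine * nat)) D L :=
  let: ((Ma, ka), (Mb, kb)) := a in
  forall z, size z ^ ka + ka <= L -> size z ^ kb + kb <= L ->
    accepts D Ma z \/ accepts D Mb z.

Definition le_state s s' :=
  [/\ frozen s <= frozen s', agree (frozen s) (base s) (base s'),
     forall e a, trusted s e = Some a -> trusted s' e = Some a &
     forall p a, active s p = Some a -> active s' p = Some a].

(** [ok_fresh] leaves [frozen s] available as the next tag or region index. [ok_active] records
    coverage for a state [s0] in which [p] was still inactive, because an oracle with an empty
    region can be valid for [s0] but breaks the promise made by activating [p]. *)
Record ok s : Prop := Ok {
  ok_frozen : 0 < frozen s;
  ok_trusted0 : trusted s 0 = None;
  ok_fresh : forall e, frozen s <= e -> trusted s e = None /\ active s e = None;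
  ok_base : valid s (base s) (frozen s);
  ok_trusted : forall e M k, trusted s e = Some (M, k) ->
    [/\ ptime M k, deterministic M & forall D L, valid s D L -> sound M k D L];
  ok_active : forall p Ma ka Mb kb, active s p = Some ((Ma, ka), (Mb, kb)) ->
    [/\ ptime Ma ka, ptime Mb kb & exists s0, [/\ le_state s0 s, active s0 p = None &
      forall D L, valid s0 D L -> covers ((Ma, ka), (Mb, kb)) D L]] }.

Lemma applies_le T v m M k x : applies T v m M k x -> pad k x <= m.
Proof. by case=> e []. Qed.

Lemma applies_inj T v m M k x M' k' x' :
  applies T v m M k x -> applies T v m M' k' x' -> [/\ M = M', k = k' & x = x'].
Proof.
case=> e [-> Te _] [e' [/tagged_word_inj[<- <-]]].
by rewrite Te => -[<- <-].
Qed.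

Lemma slow_agree D D' v m x : agree (size x) D D' -> slow D v m x -> slow D' v m x.
Proof. by move=> DD' [-> le_m nK]; split=> //; rewrite -(K_agree Menum DD'). Qed.

Lemma slow_inj D D' v m x x' : slow D v m x -> slow D' v m x' -> x = x'.
Proof. by case=> -> _ _ [/tagged_word_inj[]]. Qed.

Lemma size_lt_pow (x : word) m : 2 ^ size x <= m -> size x < m.
Proof. by apply: leq_trans; exact: ltn_expl. Qed.

Lemma le_state_refl s : le_state s s.
Proof. by split. Qed.

Lemma le_state_trans s1 s2 s3 : le_state s1 s2 -> le_state s2 s3 -> le_state s1 s3.
Proof.
case=> leN agD T12 P12 [leN' agD' T23 P23]; split.
- exact: leq_trans leN'.
- by apply: agree_trans agD _; apply: agreeW agD'.
- by move=> e a /T12/T23.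
- by move=> e a /P12/P23.
Qed.

Lemma correctW T T' D v m y : (forall e a, T e = Some a -> T' e = Some a) ->
  correct T' D v m y -> correct T D v m y.
Proof.
move=> TT' [sz nK app sl]; split=> // M k x [e [v_def /TT' Te le_m]].
by apply: (app M k); exists e.
Qed.

(** From the point of view of [s], a code of a machine trusted only in [s'] merely spells some word
    outside [K]. *)
Lemma valid_le s s' D L : le_state s s' -> valid s' D L -> valid s D L.
Proof.
case=> leN agD TT' PP' [agB cod spl]; split.
- by apply: agree_trans (agreeS agD); apply: agreeW agB.
- by move=> v m lv lt_L; have [y [cy]] := cod v m lv lt_L; exists y; split=> //; apply: correctW cy.
- move=> p n Pp; apply: spl; case Ep: (active s p) Pp => [a|//] _.
  by rewrite (PP' _ _ Ep).
Qed.

Lemma splits_agree D D' L p n : agree L D D' -> p + 3 + n < L -> splits D p n -> splits D' p n.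
Proof.
move=> DD' lt_L [b [[y sy Dy] nD]]; exists b; split.
  by exists y => //; apply/DD' => //; rewrite size_region sy.
by move=> y' sy' /(DD' (region p (~~ b) y')) H; apply: (nD y') => //; apply: H; rewrite size_region sy'.
Qed.

Lemma ltn_pad k x : size x + (size x ^ k + k) + 2 < pad k x.
Proof. by rewrite /pad; nia. Qed.

Lemma correct_agree T D D' v m y :
  (forall e M k, T e = Some (M, k) -> ptime M k) ->
  agree (size v + m + 1) D D' -> correct T D v m y -> correct T D' v m y.
Proof.
move=> Tp DD' [sz nK app sl]; split=> //.
- rewrite -(K_agree Menum (agreeW _ DD')) //.
  by case: sz => [|->//]; lia.
- move=> M k x a; have le_m := applies_le a; case: (a) => e [_ /Tp pM _].
  apply/(computes_agree _ pM (agreeW _ DD')); last exact: app a.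
  by have := ltn_pad k x; lia.
- move=> x slx; apply: sl; have [_ /size_lt_pow lt_x _] := slx.
  by apply: slow_agree slx; apply: agreeS; apply: agreeW DD'; lia.
Qed.

Lemma valid_agree s D D' L : ok s ->
  agree L D D' -> agree (frozen s) D D' -> valid s D L -> valid s D' L.
Proof.
move=> oks DD' fDD' [agB cod spl]; split.
- exact: agree_trans (agreeS fDD') agB.
- move=> v m lv lt_L; have [y [cy Dy]] := cod v m lv lt_L; exists y; split.
    apply: correct_agree cy; last by apply: agreeW DD'; lia.
    by move=> e M k /(ok_trusted oks)[].
  move=> j lt_j; have H : size (code_query v m j) < L by rewrite size_code_query.
  have := Dy j lt_j; have := DD' _ H; tauto.
- by move=> p n Pp lt_L; apply: splits_agree DD' lt_L (spl _ _ Pp lt_L).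
Qed.

Definition freeze s D L :=
  State (maxn (frozen s) L) D (trusted s) (active s).

Lemma le_freeze s D L : valid s D L -> le_state s (freeze s D L).
Proof. by case=> agB _ _; split=> //=; [lia | exact: agreeS]. Qed.

Lemma ok_freeze s D L : ok s -> valid s D L -> ok (freeze s D L).
Proof.
move=> oks vD; have le_s := le_freeze vD; have agB : agree (frozen s) D (base s) by case: vD.
have vD' : valid s D (maxn (frozen s) L).
  (* If [frozen s] is the larger bound, validity up to it is inherited from [base s]. *)
  rewrite /maxn; case: ifP => // _; apply: valid_agree oks _ _ (ok_base oks).
    exact: agreeS.
  exact: agreeS.
split=> //=.
- by have := ok_frozen oks; lia.
- exact: ok_trusted0.
- by move=> e le_e; apply: ok_fresh => //; lia.
- by case: vD' => _ cod spl; split.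
- by move=> e M k /(ok_trusted oks)[pM dM sM]; split=> // D' L' /(valid_le le_s)/sM.
- move=> p Ma ka Mb kb /(ok_active oks)[pa pb [s0 [le0 P0 cov0]]]; split=> //.
  by exists s0; split=> //; apply: le_state_trans le_s.
Qed.

End Forcing.

(** * Canonical oracles *)

Section Canonical.
Variable Menum : nat -> machine.
Notation K := (K Menum).
Notation slow := (slow Menum).
Notation value := (value Menum).
Notation correct := (correct Menum).
Notation valid := (valid Menum).
Notation ok := (ok Menum).

Lemma validW s D L L' : L' <= L -> valid s D L -> valid s D L'.
Proof.
move=> le_L [agB cod spl]; split=> //.
  by move=> v m lv lt_L; apply: cod => //; apply: leq_trans le_L.
by move=> p n Pp lt_L; apply: spl => //; apply: leq_trans le_L.
Qed.

Section Value.
Variables (s : state) (oks : ok s).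
Let T := trusted s.

Lemma applies_ptime v m M k x : applies T v m M k x -> ptime M k /\ deterministic M.
Proof. by case=> e [_ /(ok_trusted oks)[]]. Qed.

Lemma applies_not_slow D v m M k x x' : applies T v m M k x -> ~ slow D v m x'.
Proof.
case=> e [-> Te _] [/tagged_word_inj[e0 _] _ _].
by move: Te; rewrite e0 /T (ok_trusted0 oks).
Qed.

Lemma value_total D v m : exists y, value T D v m y.
Proof.
have [[M [k [x a]]]|nA] := classic (exists M k x, applies T v m M k x).
  have [y Hy] := computes_total D x (applies_ptime a).1.
  by exists y; apply: Or31; exists M, k, x.
have [[x sl]|nS] := classic (exists x, slow D v m x); first by exists x; apply: Or32.
exists [::]; apply: Or33; split=> // [M k x a|x sl]; last by apply: nS; exists x.
by apply: nA; exists M, k, x.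
Qed.

Lemma value_inj D v m y y' : value T D v m y -> value T D v m y' -> y = y'.
Proof.
case=> [[M [k [x [a Hy]]]]|sl|[-> nA nS]] [[M' [k' [x' [a' Hy']]]]|sl'|[y'0 nA' nS']] //.
- have [eM _ ex] := applies_inj a a'; rewrite -eM -ex in Hy'.
  exact: computes_inj (applies_ptime a).2 Hy Hy'.
- by case: (applies_not_slow a sl').
- by case: (nA' _ _ _ a).
- by case: (applies_not_slow a' sl).
- exact: slow_inj sl sl'.
- by case: (nS' _ sl).
- by case: (nA _ _ _ a').
- by case: (nS _ sl').
Qed.

(** Each kind of value looks only at strings shorter than the code queries for [v] and [m], so the
    recursion behind [canon] is well founded. *)
Lemma value_agree D D' v m y : agree (size v + m + 1) D D' ->
  value T D v m y -> value T D' v m y.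
Proof.
move=> DD' [[M [k [x [a Hy]]]]|sl|[-> nA nS]].
- apply: Or31; exists M, k, x; split=> //; have := applies_le a; have := ltn_pad k x.
  move=> ? ?; apply/(computes_agree _ (applies_ptime a).1 (agreeW _ (agreeS DD'))) => //; lia.
- apply: Or32; have [_ /size_lt_pow lt_y _] := sl.
  by apply: slow_agree sl; apply: agreeW DD'; lia.
- apply: Or33; split=> // x sl; apply: (nS x); have [_ /size_lt_pow lt_y _] := sl.
  by apply: slow_agree sl; apply: agreeW (agreeS DD'); lia.
Qed.

Lemma value_size D v m y : value T D v m y -> size y < m \/ y = [::].
Proof.
case=> [[M [k [x [a Hy]]]]|[_ /size_lt_pow lt_y _]|[-> _ _]]; [left|by left|by right].
have := computes_size (applies_ptime a).1 Hy; have := applies_le a; have := ltn_pad k x.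
lia.
Qed.

Lemma value_sound D L v m y : valid s D L -> m <= L -> value T D v m y -> ~ K D y.
Proof.
move=> vD le_m [[M [k [x [a Hy]]]]|[_ _ //]|[-> _ _]]; last exact: K_nil.
have [e [_ /(ok_trusted oks)[_ _ sM] le_pad]] := a.
exact: (sM _ _ vD x y (leq_trans le_pad le_m) Hy).
Qed.

Lemma value_correct D v m y : value T D v m y -> ~ K D y -> correct T D v m y.
Proof.
move=> Vy nK; split=> //; first exact: value_size Vy.
- move=> M k x a; have [y' Hy'] := computes_total D x (applies_ptime a).1.
  by rewrite (value_inj Vy (Or31 _ _ (ex_intro _ M (ex_intro _ k (ex_intro _ x (conj a Hy')))))).
- by move=> x sl; apply: value_inj Vy (Or32 _ _ sl).
Qed.

End Value.

(** One step of the recursion: [E] supplies the region strings, and code bits are computed from [D],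
    which has to be right only below the length of [q]. *)
Definition body s (E D : oracle) : oracle := fun q =>
  if size q < frozen s then base s q else
  E q \/ exists v m j y, [/\ last true v, j < m, q = code_query v m j,
    value (trusted s) D v m y & nth false (enc m y) j].

Fixpoint level s E (L : nat) : oracle :=
  if L is L'.+1 then fun q => if size q < L' then level s E L' q else body s E (level s E L') q
  else fun _ => False.

Definition canon s E : oracle := fun q => level s E (size q).+1 q.

Lemma level_canon s E L : agree L (level s E L) (canon s E).
Proof.
elim: L => [|L IHL] q //; rewrite ltnS leq_eqVlt => /orP[/eqP<- //|lt_qL].
by rewrite /= lt_qL; apply: IHL.
Qed.

Lemma body_agree s E D D' q : ok s -> agree (size q) D D' -> body s E D q -> body s E D' q.
Proof.
move=> oks DD'; rewrite /body; case: ifP => // _ [|[v [m [j [y [lv lt_j q_def Vy b]]]]]].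
  by left.
right; exists v, m, j, y; split=> //; apply: (value_agree oks) Vy.
by rewrite -(size_code_query v lt_j) -q_def.
Qed.

(** The fixed-point equation holds since [body] at [q] depends only on shorter strings, where
    [level] and [canon] already agree. *)
Lemma canonE s E q : ok s -> canon s E q <-> body s E (canon s E) q.
Proof.
move=> oks; rewrite {1}/canon /= ltnn.
have H := @level_canon s E (size q).
by split; apply: body_agree => //; apply: agreeS.
Qed.

Lemma canon_base s E : ok s -> agree (frozen s) (canon s E) (base s).
Proof. by move=> oks q lt_q; rewrite canonE // /body lt_q. Qed.

Lemma canon_region s E q : ok s -> last false q -> frozen s <= size q ->
  (canon s E q <-> E q).
Proof.
move=> oks lq le_q; rewrite canonE // /body ltnNge le_q /=; split; last by left.
by case=> // -[v [m [j [y [_ lt_j q_def _ _]]]]]; rewrite q_def last_code_query in lq.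
Qed.

Section CanonOk.
Variables (s : state) (E : oracle) (oks : ok s).
Hypothesis E_last : forall q, E q -> last false q.

Lemma canon_codes v m y : last true v -> frozen s <= size v + m + 1 ->
  value (trusted s) (canon s E) v m y -> codes (canon s E) v m y.
Proof.
move=> lv le_s Vy j lt_j; rewrite canonE // /body size_code_query // ltnNge le_s /=; split.
  case=> [/E_last|[v' [m' [j' [y' [lv' lt_j' eq_q Vy']]]]]]; first by rewrite last_code_query.
  have [ev em ej] := code_query_inj lv lv' lt_j lt_j' eq_q.
  by rewrite -ev -em -ej in Vy' *; rewrite (value_inj oks Vy Vy').
by move=> b; right; exists v, m, j, y.
Qed.

(** Induction on the length: the oracle is valid below the new length, so the soundness of trusted
    machines applies to the oracle itself and keeps the new values outside [K]. *)
Lemma canon_valid :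
  (forall p n, active s p <> None -> frozen s <= p + 3 + n -> splits E p n) ->
  forall L, valid s (canon s E) L.
Proof.
move=> Espl; have agB := canon_base E oks.
have vB : valid s (canon s E) (frozen s).
  by apply: valid_agree oks _ _ (ok_base oks); apply: agreeS.
suff H d : valid s (canon s E) (frozen s + d).
  by move=> L; apply: validW (H L); lia.
elim: d => [|d IHd]; first by rewrite addn0.
have [_ cod spl] := IHd; split=> //.
  move=> v m lv; rewrite [frozen s + _]addnS ltnS leq_eqVlt => /orP[/eqP eqL|]; last exact: cod.
  have [y Vy] := value_total oks (canon s E) v m.
  have Cy : codes (canon s E) v m y by apply: canon_codes => //; lia.
  by exists y; split=> //; apply: (value_correct oks Vy (value_sound oks IHd _ Vy)); lia.
move=> p n Pp; rewrite [frozen s + _]addnS ltnS leq_eqVlt => /orP[/eqP eqL|]; last exact: spl.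
have [|b [[y sy Dy] nD]] := Espl p n Pp; first by rewrite eqL leq_addr.
have H b' y' : size y' = n -> (canon s E (region p b' y') <-> E (region p b' y')).
  by move=> sy'; apply: canon_region => //; rewrite ?last_region // size_region sy' eqL leq_addr.
exists b; split; first by exists y => //; apply/H.
by move=> y' sy'; rewrite H //; apply: nD.
Qed.

End CanonOk.

Definition default_region : oracle := fun q => exists p n, q = region p false (nseq n false).

Lemma default_region_last q : default_region q -> last false q.
Proof. by case=> p [n ->]; apply: last_region. Qed.

Lemma default_region_splits p n : splits default_region p n.
Proof.
exists false; split; first by exists (nseq n false); [rewrite size_nseq | exists p, n].
by move=> y _ [p' [n' /region_inj[]]].
Qed.

(** Freezing one more length moves the number [frozen s] below the new bound, so that it can be
    handed out as a tag or region index without violating [ok_fresh]. *)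
Lemma ok_extend s : ok s -> exists s', [/\ ok s', le_state s s', frozen s' = (frozen s).+1,
   trusted s' = trusted s & active s' = active s].
Proof.
move=> oks; set D := canon s default_region.
have vD : valid s D (frozen s).+1.
  apply: canon_valid => //; first exact: default_region_last.
  by move=> p n _ _; apply: default_region_splits.
exists (freeze s D (frozen s).+1); split=> //.
- exact: (ok_freeze oks vD).
- exact: (le_freeze vD).
- by rewrite /=; apply/maxn_idPr.
Qed.

End Canonical.

(** * Polynomial bounds *)

Definition poly_bounded (f : nat -> nat) := exists a b, forall n, f n <= a * n.+1 ^ b.

Lemma poly_id : poly_bounded id.
Proof. by exists 1, 1 => n; lia. Qed.

Lemma poly_const c : poly_bounded (fun _ => c).
Proof. by exists c, 0 => n; lia. Qed.

Lemma poly_add f g : poly_bounded f -> poly_bounded g -> poly_bounded (fun n => f n + g n).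
Proof.
case=> a [b Hf] [a' [b' Hg]]; exists (a + a'), (b + b') => n.
rewrite mulnDl; apply: leq_add; [apply: leq_trans (Hf n) _ | apply: leq_trans (Hg n) _];
  by rewrite leq_mul2l leq_pexp2l ?orbT ?leq_addr ?leq_addl.
Qed.

Lemma poly_mul f g : poly_bounded f -> poly_bounded g -> poly_bounded (fun n => f n * g n).
Proof.
case=> a [b Hf] [a' [b' Hg]]; exists (a * a'), (b + b') => n.
by rewrite expnD mulnACA; apply: leq_mul.
Qed.

Lemma poly_exp f k : poly_bounded f -> poly_bounded (fun n => f n ^ k).
Proof.
case=> a [b Hf]; exists (a ^ k), (b * k) => n.
by rewrite expnM -expnMn; case: k => // k; rewrite leq_exp2r.
Qed.

Lemma poly_le f g : (forall n, f n <= g n) -> poly_bounded g -> poly_bounded f.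
Proof. by move=> fg [a [b Hg]]; exists a, b => n; apply: leq_trans (Hg n). Qed.

Lemma poly_lt_exp f N : poly_bounded f -> exists2 n, N <= n & f n < 2 ^ n.
Proof.
(* For [n = 2 ^ t] the polynomial is at most [2 ^ (a + (t + 1) * b)], up to a strict factor, and
   [a + (t + 1) * b <= 2 ^ t] follows from [t * t <= 2 * 2 ^ t]. *)
case=> a [b Hf]; set t := 2 * (a + b + N) + 4.
exists (2 ^ t); first by have := ltn_expl t (isT : 1 < 2); rewrite /t; lia.
apply: leq_ltn_trans (Hf _) _.
have lt_a : a < 2 ^ a by apply: ltn_expl.
apply: (@leq_trans (2 ^ a * (2 ^ t.+1) ^ b)).
  have pt : 0 < 2 ^ t by rewrite expn_gt0.
  have le_t : (2 ^ t).+1 <= 2 ^ t.+1 by rewrite expnS; lia.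
  have pos : 0 < (2 ^ t).+1 ^ b by rewrite expn_gt0.
  apply: (@leq_trans (2 ^ a * (2 ^ t).+1 ^ b)); first by rewrite ltn_mul2r pos.
  rewrite leq_mul2l; case: (posnP b) => [b0|b_gt0]; first by rewrite b0 !expn0 orbT.
  by rewrite leq_exp2r // le_t orbT.
rewrite -expnM -expnD leq_exp2l //.
have sq n : n * n <= 2 * 2 ^ n.
  elim: n => // n IHn; have : n < 2 ^ n by apply: ltn_expl.
  rewrite expnS; case: n IHn => [|[|[|n]]] //; nia.
have := sq t; rewrite /t; nia.
Qed.

Lemma poly_ptime f : poly_bounded f -> exists k, forall n, f n <= n ^ k + k.
Proof.
(* For [n <= 1] the additive constant suffices; for larger [n], [a < n ^ a] and [n + 1 <= n ^ 2]
   bound everything by [n ^ (a + 2 * b)]. *)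
case=> a [b Hf]; exists (a * 2 ^ b + 2 * b + a) => n.
apply: leq_trans (Hf n) _; have pos : 0 < 2 ^ b by rewrite expn_gt0.
case: n => [|[|n]]; first by rewrite exp1n; nia.
  by rewrite exp1n; nia.
apply: leq_trans (leq_addr _ _).
have lt_a : a < n.+2 ^ a by apply: ltn_expl.
apply: (@leq_trans (n.+2 ^ a * (n.+2 ^ 2) ^ b)).
  apply: leq_mul; first exact: ltnW.
  by case: b {Hf pos} => // b; rewrite leq_exp2r //; nia.
by rewrite -expnM -expnD leq_pexp2l //; lia.
Qed.

(** * Sensitivity to a region and diagonalization *)

Section Dependency.
Variable Menum : nat -> machine.
Notation K := (K Menum).
Notation slow := (slow Menum).
Notation value := (value Menum).
Notation correct := (correct Menum).
Notation valid := (valid Menum).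
Notation ok := (ok Menum).
Notation canon := (canon Menum).

Variables (s : state) (oks : ok s) (p n : nat).

(** Every region is split in the default way except that of [p] and [n], which stays empty; [plug]
    repairs it by a single string. *)
Definition hole : oracle := fun q =>
  exists p' n', (p', n') <> (p, n) /\ q = region p' false (nseq n' false).
Definition plug (u : word) : oracle := fun q => hole q \/ q = u.

Let D0 := canon s hole.
Let D1 u := canon s (plug u).
Definition in_region u := exists b y, size y = n /\ u = region p b y.

(* Adding a string of the region outside a list of size at most [b] is invisible. *)
Definition insensitive (b : nat) (Q : word -> Prop) :=
  exists S : seq word, size S <= b /\ forall u, in_region u -> u \notin S -> Q u.

Lemma insensitiveW b b' Q : b <= b' -> insensitive b Q -> insensitive b' Q.
Proof. by move=> le_b [S [le_S HS]]; exists S; split=> //; apply: leq_trans le_b. Qed.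

Lemma insensitive_and b1 b2 Q1 Q2 : insensitive b1 Q1 -> insensitive b2 Q2 ->
  insensitive (b1 + b2) (fun u => Q1 u /\ Q2 u).
Proof.
case=> S1 [le1 H1] [S2 [le2 H2]]; exists (S1 ++ S2).
rewrite size_cat; split; first exact: leq_add.
by move=> u ru; rewrite mem_cat negb_or => /andP[u1 u2]; split; [apply: H1 | apply: H2].
Qed.

Lemma insensitive_imp b (Q1 Q2 : word -> Prop) : (forall u, in_region u -> Q1 u -> Q2 u) ->
  insensitive b Q1 -> insensitive b Q2.
Proof. by move=> imp [S [le_S HS]]; exists S; split=> // u ru uS; apply: imp (HS _ _ _). Qed.

(** Each half of the region has [2 ^ n] strings, more than the exceptional list can contain, so the
    bit [c] may be chosen freely. *)
Lemma insensitive_pick c b Q : b < 2 ^ n -> insensitive b Q ->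
  exists y, size y = n /\ Q (region p c y).
Proof.
move=> lt_b [S [le_S HS]]; apply: NNPP => none.
pose X := [seq region p c (val y) | y <- enum {: n.-tuple bool}].
have uX : uniq X.
  by rewrite map_inj_uniq ?enum_uniq // => y y' /region_inj[_ _ /val_inj].
have XS : {subset X <= S}.
  move=> _ /mapP[y _ ->]; apply: contraT => yS; case: none.
  exists (val y); split; first exact: size_tuple.
  by apply: HS => //; exists c, (val y); rewrite size_tuple.
have := uniq_leq_size uX XS; rewrite size_map -cardE card_tuple card_bool => le_2.
by have := leq_trans (leq_ltn_trans le_S lt_b) le_2; rewrite ltnn.
Qed.

(** The linear bound is the induction invariant: a computation with time bound [b] depends on at
    most [b * b] region strings, and the quadratic [pad] brings this back to linear in the length of
    a code query. *)
Definition stable (q : word) := insensitive (size q) (fun u => D0 q <-> D1 u q).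

Lemma certified_insensitive b Q : (forall q : word, size q < b -> stable q) ->
  certified b Q D0 -> insensitive (b * b) (fun u => Q (D1 u)).
Proof.
move=> st [qs [le_qs lt_b HQ]].
suff [S [le_S HS]] : insensitive (size qs * b) (fun u => forall q, q \in qs -> (D0 q <-> D1 u q)).
  exists S; split; first by apply: leq_trans le_S _; rewrite leq_mul2r le_qs orbT.
  by move=> u ru uS; apply: HQ; apply: HS.
elim: qs lt_b {le_qs HQ} => [|q qs IHqs] lt_b; first by exists [::].
have lt_q : size q < b by apply: lt_b; rewrite inE eqxx.
have Hqs : forall q', q' \in qs -> size q' < b by move=> q' q'qs; apply: lt_b; rewrite inE q'qs orbT.
have := insensitive_and (insensitiveW (ltnW lt_q) (st q lt_q)) (IHqs Hqs).
by apply: insensitive_imp => u _ [Hq Hr] q'; rewrite inE => /orP[/eqP->|/Hr].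
Qed.

Lemma plug_last u q : in_region u -> plug u q -> last false q.
Proof. by case=> b [y [_ ->]] [[p' [n' [_ ->]]]|->]; apply: last_region. Qed.

Lemma hole_last q : hole q -> last false q.
Proof. by case=> p' [n' [_ ->]]; apply: last_region. Qed.

Lemma in_region_size (u : word) : in_region u -> size u = p + 3 + n.
Proof. by case=> b [y [sy ->]]; rewrite size_region sy. Qed.

Lemma plug_agree u : in_region u -> agree (p + 3 + n) D0 (D1 u).
Proof.
move=> /in_region_size su.
suff H L : L <= p + 3 + n -> agree L D0 (D1 u) by apply: H.
elim: L => [|L IHL] le_L q //; rewrite ltnS leq_eqVlt => /orP[/eqP eqL|]; last by apply: IHL; lia.
have D0D1 := IHL (ltnW le_L); rewrite -eqL in D0D1 le_L.
rewrite /D0 /D1 !canonE // -/D0 -/(D1 u).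
split=> [/(body_agree oks D0D1)|/(body_agree oks (agreeS D0D1))]; rewrite /body; case: ifP => //.
  by move=> _ [?|?]; [left; left | right].
by move=> _ [[?|q_u]|?]; [left | move: le_L; rewrite q_u su ltnn | right].
Qed.

(** Membership of [x] in [K] can depend on the region only if the region strings are shorter than
    [x]; all [2 ^ n.+1] of them are then at most [2 ^ size x <= m] many. Hence the exponential
    padding of tag 0. *)
Lemma slow_insensitive (x : word) m : 2 ^ size x <= m -> insensitive m (fun u => agree (size x) D0 (D1 u)).
Proof.
move=> le_m; have [lt_x|le_x] := ltnP (p + 3 + n) (size x); last first.
  by exists [::]; split=> // u ru _; apply: agreeW (plug_agree ru).
pose X b := [seq region p b (val y) | y <- enum {: n.-tuple bool}].
have sX b : size (X b) = 2 ^ n by rewrite size_map -cardE card_tuple card_bool.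
exists (X false ++ X true); rewrite size_cat !sX; split.
  apply: leq_trans le_m; rewrite addnn -mul2n -expnS leq_exp2l //; lia.
move=> u [b [y [sy ->]]]; rewrite mem_cat; suff : region p b y \in X b by case: b => ->; rewrite ?orbT.
have sy' : size y == n by apply/eqP.
by apply/mapP; exists (Tuple sy'); rewrite ?mem_enum.
Qed.

Lemma value_insensitive v m y : (forall q : word, size q < size v + m + 1 -> stable q) ->
  value (trusted s) D0 v m y -> insensitive m (fun u => value (trusted s) (D1 u) v m y).
Proof.
move=> st Vy.
have [[M [k [x a]]]|nA] := classic (exists M k x, applies (trusted s) v m M k x).
  have Hy : computes D0 M x y.
    case: Vy => [[M' [k' [x' [a' Hy]]]]|sl|[_ nA _]]; last by case: (nA _ _ _ a).
      by have [-> _ ->] := applies_inj a a'.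
    by case: (applies_not_slow oks a sl).
  have [pM _] := applies_ptime oks a; have le_m := applies_le a.
  have st' : forall q : word, size q < size x ^ k + k -> stable q.
    by move=> q lt_q; apply: st; have := ltn_pad k x; lia.
  apply: insensitiveW (insensitive_imp _ (certified_insensitive st' (computes_certified pM Hy))).
    by apply: leq_trans le_m; rewrite /pad; nia.
  by move=> u _ Hu; apply: Or31; exists M, k, x.
have nA' : forall M k x, ~ applies (trusted s) v m M k x by move=> M k x a; apply: nA; exists M, k, x.
(* The condition that [x] is not in [K] is left out of this case split, since its truth may change
   with the oracle. *)
have [[x [v_def le_m]]|nS] := classic (exists x, v = tagged_word 0 x /\ 2 ^ size x <= m).
  apply: insensitive_imp (slow_insensitive le_m) => u _ agx.
  case: Vy => [[M [k [x' [/nA' []]]]]|sl|[-> _ nS]].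
    have [e _ _] := sl; apply: Or32; apply: slow_agree sl.
    by move: e; rewrite v_def => /tagged_word_inj[_ <-].
  apply: Or33; split=> // x' sl; have [e _ _] := sl; apply: (nS x'); apply: slow_agree sl.
  by move: e; rewrite v_def => /tagged_word_inj[_ <-]; apply: agreeS.
exists [::]; split=> // u _ _; case: Vy => [[M [k [x' [/nA' []]]]]|[e le_m _]|[-> _ _]].
  by case: nS; exists y.
by apply: Or33; split=> // x [e le_m _]; apply: nS; exists x.
Qed.

(** Strong induction on the length. Frozen strings depend on nothing, strings ending in [true] only
    on themselves, code queries on at most [m] region strings, and all other strings are never in
    the oracle. *)
Lemma stability q : stable q.
Proof.
have [L le_L] := ubnP (size q); elim: L q le_L => // L IHL q le_L.
have st q' : size q' < size q -> stable q' by move=> lt_q; apply: IHL; lia.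
have [lt_q|le_q] := ltnP (size q) (frozen s).
  exists [::]; split=> // u _ _.
  by have := canon_base hole oks lt_q; have := canon_base (plug u) oks lt_q; rewrite /D0 /D1; tauto.
have [lq|lq] := boolP (last false q).
  exists [:: q]; split=> [|u ru]; first by case: q lq {le_L st le_q}.
  rewrite inE eq_sym => /eqP neq_q; rewrite /D0 /D1 !canon_region //.
  by split=> [|[|]] //; left.
have [[v [m [j [lv lt_j q_def]]]]|nq] := classic (exists v m j,
    [/\ last true v, j < m & q = code_query v m j]).
  have sq : size q = size v + m + 1 by rewrite q_def size_code_query.
  have [y Vy] := value_total oks D0 v m.
  rewrite sq in st le_q; rewrite /stable sq.
  apply: insensitiveW (insensitive_imp _ (value_insensitive st Vy)); first lia.
  move=> u ru Vu; rewrite q_def.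
  have := canon_codes oks hole_last lv le_q Vy lt_j.
  have := canon_codes oks (@plug_last u ^~ ru) lv le_q Vu lt_j.
  by rewrite -/D0 -/(D1 u); tauto.
exists [::]; split=> // u ru _; rewrite /D0 /D1 !canonE // /body ltnNge le_q /=.
split=> -[|[v [m [j [y [lv lt_j q_def _ _]]]]]].
- by move/hole_last; rewrite (negbTE lq).
- by case: nq; exists v, m, j.
- by move/(plug_last ru); rewrite (negbTE lq).
- by case: nq; exists v, m, j.
Qed.

Lemma plug_splits b y p' n' : size y = n -> splits (plug (region p b y)) p' n'.
Proof.
move=> sy; have [[-> ->]|neq] := eqVneq (p', n') (p, n).
  exists b; split; first by exists y => //; right.
  move=> y' sy' [[p2 [n2 [neq /region_inj[e2 _ e3]]]]|/region_inj[]]; last by case: b.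
  by apply: neq; rewrite -e2 -sy' e3 size_nseq.
exists false; split.
  exists (nseq n' false); first by rewrite size_nseq.
  by left; exists p', n'; split=> //; apply/eqP.
move=> y' sy' [[p2 [n2 [_ /region_inj[]]]]|/region_inj[e1 _ e2]] //.
by rewrite e1 -sy' e2 sy eqxx in neq.
Qed.

Lemma plug_valid b y L : size y = n -> valid s (D1 (region p b y)) L.
Proof.
move=> sy; have ru : in_region (region p b y) by exists b, y.
by apply: canon_valid => [//|q /(plug_last ru)|p' n' _ _]; last exact: plug_splits.
Qed.

Lemma plug_not_region b y y' : frozen s <= n -> size y = n -> size y' = n ->
  ~ D1 (region p b y) (region p (~~ b) y').
Proof.
move=> le_n sy sy'; rewrite /D1 canon_region ?last_region ?size_region //; last by lia.
case=> [[p2 [n2 [neq /region_inj[e2 _ e3]]]]|/region_inj[]]; last by case: b.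
by apply: neq; rewrite -e2 -sy' e3 size_nseq.
Qed.

(** Nothing is promised about region [p] in [s0], so only the codes matter. If one spelled an
    element of [K], some plugged string would preserve both the value and its membership in [K],
    although the plugged oracle is valid for [s] and thus has sound values. The term [L] counts the
    dependencies of the value, [L * L] those of membership in [K]. *)
Lemma hole_valid s0 L : L + L * L < 2 ^ n -> le_state s0 s -> active s0 p = None ->
  valid s0 D0 L.
Proof.
move=> lt_L le_s P0; have agB := canon_base hole oks.
have vB : valid s D0 (frozen s).
  by apply: valid_agree oks _ _ (ok_base oks); apply: agreeS.
have vB0 := valid_le le_s vB; split; first by case: vB0.
- move=> v m lv lt_vm; have [lt_f|le_f] := ltnP (size v + m + 1) (frozen s).
    by case: vB0 => _ cod _; apply: cod.
  have [y Vy] := value_total oks D0 v m.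
  exists y; split; last exact: (canon_codes oks hole_last).
  case: (le_s) => _ _ leT _; apply: correctW leT _.
  apply: (value_correct oks Vy) => Ky.
  have ins1 := value_insensitive (fun q _ => stability q) Vy.
  have ins2 := certified_insensitive (fun q _ => stability q) (K_certified Ky).
  have sy : size y <= L by case: (value_size oks Vy) => [|->//]; lia.
  have [|y' [sy' [Vy' Ky']]] := insensitive_pick false _ (insensitive_and ins1 ins2).
    by apply: leq_ltn_trans lt_L; apply: leq_add; [lia | apply: leq_mul].
  by apply: (value_sound oks (plug_valid false L sy') _ Vy' Ky'); lia.
- move=> p' n' Pp lt_pn; have [lt_f|le_f] := ltnP (p' + 3 + n') (frozen s).
    by case: vB0 => _ _ spl; apply: spl.
  have H b' y' : size y' = n' -> (D0 (region p' b' y') <-> hole (region p' b' y')).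
    by move=> sy'; apply: canon_region => //; rewrite ?last_region // size_region sy'.
  exists false; split.
    exists (nseq n' false); first by rewrite size_nseq.
    rewrite H ?size_nseq //; exists p', n'; split=> // -[p'p _].
    by apply: Pp; rewrite p'p.
  by move=> y sy; rewrite H // => -[p2 [n2 [_ /region_inj[]]]].
Qed.

End Dependency.

(** * Defeating one reduction *)

Section Diagonalization.
Variable Menum : nat -> machine.
Notation valid := (valid Menum).
Notation ok := (ok Menum).

Definition misreduced (D : oracle) p n Ma Mb z :=
  (accepts D Ma z /\ forall y, size y = n -> ~ D (region p false y)) \/
  (accepts D Mb z /\ forall y, size y = n -> ~ D (region p true y)).

Lemma diagonalize s p Ma ka Mb kb M k : ok s ->
  active s p = Some ((Ma, ka), (Mb, kb)) -> ptime M k -> deterministic M ->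
  exists D L n z, [/\ valid s D L, n ^ k + k <= L /\ p + 3 + n < L,
    size z ^ ka + ka <= L /\ size z ^ kb + kb <= L,
    computes D M (nseq n false) z & misreduced D p n Ma Mb z].
Proof.
move=> oks Pp pM dM; have [pMa pMb [s0 [le_s P0 cov]]] := ok_active oks Pp.
(* [Z] bounds the length of the output of [M] on [0^n], and [L] exceeds all lengths that the verdict
   depends on. *)
pose Z n := n + (n ^ k + k) + 2.
pose L n := n ^ k + k + (Z n ^ ka + ka) + (Z n ^ kb + kb) + (p + 3 + n) + 1.
have pZ : poly_bounded Z.
  exact: (poly_add (poly_add poly_id (poly_add (poly_exp k poly_id) (poly_const k))) (poly_const 2)).
(* The square pays for the computation of [M]; [L + L * L] pays for the validity of the oracle with
   the hole, and its second summand also for the acceptance of [z]. *)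
have pL : poly_bounded (fun n => (n ^ k + k) * (n ^ k + k) + (L n + L n * L n)).
  have pk := poly_add (poly_exp k poly_id) (poly_const k).
  have pLn : poly_bounded L.
    apply: poly_add (poly_const _); apply: poly_add; last exact: poly_add (poly_const _) poly_id.
    apply: poly_add; last exact: poly_add (poly_exp _ pZ) (poly_const _).
    by apply: poly_add pk _; exact: poly_add (poly_exp _ pZ) (poly_const _).
  by apply: poly_add; [apply: poly_mul | apply: poly_add; last apply: poly_mul].
have [n le_n lt_n] := poly_lt_exp (frozen s) pL.
pose D0 := canon Menum s (hole p n); pose D1 u := canon Menum s (plug p n u).
have v0 : valid s0 D0 (L n) by apply: hole_valid => //; lia.
have [z Hz] := computes_total D0 (nseq n false) pM.
have sz : size z <= Z n.
  by have := computes_size pM Hz; rewrite size_nseq /Z; lia.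
have le_exp c : size z ^ c <= Z n ^ c by case: c => // c; rewrite leq_exp2r.
have la := le_exp ka; have lb := le_exp kb.
have ins1 := certified_insensitive (fun q _ => stability oks p n q) (computes_certified pM Hz).
rewrite size_nseq in ins1.
have le_a : size z ^ ka + ka <= L n by rewrite /L; lia.
have le_b : size z ^ kb + kb <= L n by rewrite /L; lia.
(* [c] is true when [Ma] accepts. The plugged string then lies in the half [true], so the half
   [false] stays empty although the image of [0^n] is accepted by [Ma]; the other case is
   symmetric. *)
have [c Mc Hc] : exists2 c : bool, ptime (if c then Ma else Mb) (if c then ka else kb) &
    accepts D0 (if c then Ma else Mb) z.
  by case: (cov _ _ v0 z le_a le_b) => H; [exists true | exists false].
have ins2 := certified_insensitive (fun q _ => stability oks p n q) (accepts_certified Mc Hc).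
have [|y [sy [Hy1 Hy2]]] := insensitive_pick c _ (insensitive_and ins1 ins2).
  apply: leq_ltn_trans lt_n; rewrite leq_add2l.
  by apply: leq_trans (leq_addl _ _); apply: leq_mul; case: (c).
exists (D1 (region p c y)), (L n), n, z; split=> //.
- exact: plug_valid.
- by rewrite /L; lia.
have nR y' : size y' = n -> ~ D1 (region p c y) (region p (~~ c) y').
  by move=> sy'; apply: plug_not_region.
by case: c {Mc Hc ins2} Hy1 Hy2 nR => Hy1 Hy2 nR; [left|right]; split=> // y' sy'; apply: (nR y').
Qed.

End Diagonalization.

(** * The generic oracle *)

Definition code_trans (tr : trans) :=
  (t_from tr, t_read tr, t_write tr,
   match t_move tr with MoveL => Some false | MoveR => Some true | Stay => None end,
   t_query tr, t_to tr).

Definition decode_trans c :=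
  let: (f, r, w, mv, qu, t) := c in
  Trans f r w (match mv with Some false => MoveL | Some true => MoveR | None => Stay end) qu t.

Lemma code_transK : cancel code_trans decode_trans.
Proof. by case=> f r w []. Qed.

Definition code_machine M :=
  (map code_trans (m_trans M), m_start M, m_qask M, m_qyes M, m_qno M, m_qacc M).

Lemma code_machine_inj : injective code_machine.
Proof.
case=> t s a y n c [t' s' a' y' n' c'] [/(inj_map (can_inj code_transK)) -> -> -> -> -> ->] //.
Qed.

Lemma machine_enum : exists E : nat -> machine, forall M, exists i, E i = M.
Proof.
pose M0 := Machine [::] 0 0 0 0 0.
pose R i M := pickle (code_machine M) = i.
exists (fun i => epsilon (inhabits M0) (R i)) => M.
exists (pickle (code_machine M)); apply: code_machine_inj.
apply: (pcan_inj pickleK); apply: (epsilon_spec (inhabits M0) (R _)).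
by exists M.
Qed.

Section Construction.
Variable Menum : nat -> machine.
Notation K := (K Menum).
Notation valid := (valid Menum).
Notation ok := (ok Menum).

Definition below s (O : oracle) := agree (frozen s) O (base s).

Lemma below_le s s' O : le_state s s' -> below s' O -> below s O.
Proof.
by case=> le_s agD _ _ bO; apply: agree_trans (agreeS agD); apply: agreeW bO.
Qed.

Definition trust_met s M k := ptime M k -> deterministic M ->
  (exists e, trusted s e = Some (M, k)) \/
  (forall O, below s O -> exists x y, computes O M x y /\ K O y).

Definition active_met s Ma ka Mb kb := ptime Ma ka -> ptime Mb kb ->
  (exists p, active s p = Some ((Ma, ka), (Mb, kb))) \/
  (forall O, below s O -> exists z, ~ accepts O Ma z /\ ~ accepts O Mb z).

Definition diag_met s s' p M k := ptime M k -> deterministic M ->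
  forall Ma ka Mb kb, active s p = Some ((Ma, ka), (Mb, kb)) ->
  forall O, below s' O ->
  exists n z, computes O M (nseq n false) z /\ misreduced O p n Ma Mb z.

Lemma trust_step s M k : ok s -> exists s', [/\ ok s', le_state s s' & trust_met s' M k].
Proof.
move=> oks.
have [[pM dM]|nM] := classic (ptime M k /\ deterministic M); last first.
  by exists s; split=> // pM dM; case: nM.
have [[D [L [vD nS]]]|allS] := classic (exists D L, valid s D L /\ ~ sound Menum M k D L).
  exists (freeze s D L); split; first exact: (ok_freeze oks vD).
    exact: (le_freeze vD).
  move=> _ _; right=> O bO; apply: NNPP => none; apply: nS => x y le_x Hy Ky; apply: none.
  have DO : agree L D O by apply: agreeS; apply: agreeW bO; rewrite /= leq_maxr.
  have lt_p := ltn_pad k x; have lt_y := computes_size pM Hy; exists x, y; split.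
    by apply/(computes_agree _ pM (agreeW _ (agreeS DO))) => //; lia.
  by apply/(K_agree Menum (agreeW _ (agreeS DO))) => //; lia.
have [s1 [ok1 le1 eqN eqT eqA]] := ok_extend oks.
pose T e := if e == frozen s then Some (M, k) else trusted s1 e.
have T_out e a : trusted s1 e = Some a -> T e = Some a.
  by rewrite /T; case: eqP => // ->; rewrite eqT (ok_fresh oks (leqnn _)).1.
pose s2 := State (frozen s1) (base s1) T (active s1).
have le12 : le_state s1 s2 by split.
exists s2; split; last by move=> _ _; left; exists (frozen s); rewrite /= /T eqxx.
  have [f0 T0 fr [agB cod spl] okT okP] := ok1; split=> //=.
  - by rewrite /T; case: eqP => // /esym f00; have := ok_frozen oks; rewrite f00.
  - move=> e le_e; have [Te Pe] := fr e le_e; split=> //.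
    by rewrite /T; case: eqP => // ee; rewrite ee eqN ltnn in le_e.
  - split=> // v m lv lt_m; have [y [[sz nK app sl] Dy]] := cod v m lv lt_m.
    exists y; split=> //; split=> // M' k' x [e [v_def Te le_m]].
    apply: (app M' k'); exists e; split=> //; move: Te; rewrite /= /T; case: eqP => // ee _.
    by move: lt_m; rewrite v_def /tagged_word size_cat size_nseq /= ee; have := ltn_pad k' x; lia.
  - move=> e M' k'; rewrite /T; case: eqP => [_ [<- <-]|_ /okT[pM' dM' sM']]; split=> //.
      move=> D L /(valid_le le12)/(valid_le le1) vD; apply: NNPP => nS.
      by apply: allS; exists D, L.
    by move=> D L /(valid_le le12)/sM'.
  - move=> p Ma ka Mb kb /okP[pa pb [s0 [le0 P0 cov0]]]; split=> //.
    by exists s0; split=> //; apply: le_state_trans le12.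
exact: le_state_trans le12.
Qed.

Lemma active_step s Ma ka Mb kb : ok s ->
  exists s', [/\ ok s', le_state s s' & active_met s' Ma ka Mb kb].
Proof.
move=> oks.
have [[pa pb]|nM] := classic (ptime Ma ka /\ ptime Mb kb); last first.
  by exists s; split=> // pa pb; case: nM.
have [[D [L [vD nS]]]|allS] :=
    classic (exists D L, valid s D L /\ ~ covers ((Ma, ka), (Mb, kb)) D L).
  exists (freeze s D L); split; first exact: (ok_freeze oks vD).
    exact: (le_freeze vD).
  move=> _ _; right=> O bO; apply: NNPP => none; apply: nS => z le_a le_b.
  apply: NNPP => nacc; apply: none; exists z.
  have OD : agree L O D by apply: agreeW bO; rewrite /= leq_maxr.
  have := accepts_agree pa (agreeW le_a OD); have := accepts_agree pb (agreeW le_b OD); tauto.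
have [s1 [ok1 le1 eqN eqT eqA]] := ok_extend oks.
pose P p := if p == frozen s then Some ((Ma, ka), (Mb, kb)) else active s1 p.
have P_out p a : active s1 p = Some a -> P p = Some a.
  by rewrite /P; case: eqP => // ->; rewrite eqA (ok_fresh oks (leqnn _)).2.
pose s2 := State (frozen s1) (base s1) (trusted s1) P.
have le12 : le_state s1 s2 by split.
exists s2; split; last by move=> _ _; left; exists (frozen s); rewrite /= /P eqxx.
  have [f0 T0 fr [agB cod spl] okT okP] := ok1; split=> //=.
  - move=> p le_p; have [Tp Pp] := fr p le_p; split=> //.
    by rewrite /P; case: eqP => // pp; rewrite pp eqN ltnn in le_p.
  - split=> // p n; rewrite /= /P; case: eqP => [-> _ lt_n|_]; last exact: spl.
    by move: lt_n; rewrite /= eqN; lia.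
  - by move=> e M k /okT[pM dM sM]; split=> // D L /(valid_le le12)/sM.
  - move=> p Ma' ka' Mb' kb'; rewrite /P.
    case: eqP => [-> [<- <- <- <-]|_ /okP[pa' pb' [s0 [le0 P0 cov0]]]]; split=> //.
      (* The state just before activation serves as [s0]. *)
      exists s; split=> //; first exact: le_state_trans le12.
        exact: (ok_fresh oks (leqnn _)).2.
      by move=> D L vD; apply: NNPP => nS; apply: allS; exists D, L.
    by exists s0; split=> //; apply: le_state_trans le12.
exact: le_state_trans le12.
Qed.

Lemma misreduced_agree D O L p n Ma ka Mb kb z : ptime Ma ka -> ptime Mb kb ->
  agree L D O -> p + 3 + n < L -> size z ^ ka + ka <= L -> size z ^ kb + kb <= L ->
  misreduced D p n Ma Mb z -> misreduced O p n Ma Mb z.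
Proof.
move=> pa pb DO lt_n le_a le_b.
have R b : (forall y, size y = n -> ~ D (region p b y)) ->
    forall y, size y = n -> ~ O (region p b y).
  by move=> nD y sy; rewrite -DO ?size_region ?sy //; apply: nD.
case=> -[acc /R nR]; [left | right]; split=> //.
  exact/(accepts_agree pa (agreeW le_a (agreeS DO))).
exact/(accepts_agree pb (agreeW le_b (agreeS DO))).
Qed.

Lemma diag_step s p M k : ok s -> exists s', [/\ ok s', le_state s s' & diag_met s s' p M k].
Proof.
move=> oks.
have [[pM dM]|nM] := classic (ptime M k /\ deterministic M); last first.
  by exists s; split=> // pM dM; case: nM.
case E: (active s p) => [[[Ma ka] [Mb kb]]|]; last first.
  by exists s; split=> // _ _ Ma ka Mb kb; rewrite E.
have [pa pb _] := ok_active oks E.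
have [D [L [n [z [vD [le_k lt_n] [le_a le_b] Hz mis]]]]] := diagonalize oks E pM dM.
exists (freeze s D L); split; first exact: (ok_freeze oks vD).
  exact: (le_freeze vD).
move=> _ _ Ma' ka' Mb' kb'; rewrite E => -[<- _ <- _] O bO.
have DO : agree L D O by apply: agreeS; apply: agreeW bO; rewrite /= leq_maxr.
exists n, z; split; last exact: misreduced_agree pa pb DO _ _ _ mis.
apply/(computes_agree _ pM (agreeW _ (agreeS DO))); last exact: Hz.
by rewrite size_nseq.
Qed.

Definition stage_met s s' Ma ka Mb kb p :=
  [/\ trust_met s' Ma ka, active_met s' Ma ka Mb kb & diag_met s s' p Ma ka].

Lemma stage_step s Ma ka Mb kb p : ok s -> exists s',
  [/\ ok s', le_state s s', frozen s < frozen s' & stage_met s s' Ma ka Mb kb p].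
Proof.
move=> ok0; have [s1 [ok1 le1 m1]] := diag_step p Ma ka ok0.
have [s2 [ok2 le2 m2]] := active_step Ma ka Mb kb ok1.
have [s3 [ok3 le3 m3]] := trust_step Ma ka ok2.
have [s4 [ok4 le4 eqN eqT eqA]] := ok_extend ok3.
have le34 := le_state_trans le3 le4; have le24 := le_state_trans le2 le34.
exists s4; split=> //; first exact: le_state_trans le1 le24.
  by case: le1 le2 le3 => [? _ _ _] [? _ _ _] [? _ _ _]; lia.
split.
- move=> pM dM; have [[e Te]|nS] := m3 pM dM; first by left; exists e; rewrite eqT.
  by right=> O bO; apply: nS; apply: below_le le4 bO.
- move=> pa pb; have [[q Pq]|nC] := m2 pa pb.
    by left; exists q; case: le34 => _ _ _; apply.
  by right=> O bO; apply: nC; apply: below_le le34 bO.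
- move=> pM dM Ma' ka' Mb' kb' Pp O bO.
  exact: m1 pM dM _ _ _ _ Pp _ (below_le le24 bO).
Qed.

(** Starting with [frozen] equal to 1 prevents tag 0 from ever being handed out as fresh. *)
Lemma ok_initial : ok (State 1 (fun _ => False) (fun _ => None) (fun _ => None)).
Proof.
split=> //=; split=> //= v m _; first by rewrite addn1.
Qed.

Theorem generic_oracle : exists O : oracle,
  [/\ forall v m, last true v -> exists y,
        [/\ size y < m \/ y = [::], ~ K O y & codes O v m y],
     forall x m, 2 ^ size x <= m -> ~ K O x -> codes O (tagged_word 0 x) m x,
     forall M k, ptime M k -> deterministic M ->
       (exists x y, computes O M x y /\ K O y) \/
       (exists2 e, 0 < e & forall x m, pad k x <= m -> exists y,
          [/\ size y < m \/ y = [::], computes O M x y & codes O (tagged_word e x) m y]) &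
     forall Ma ka Mb kb, ptime Ma ka -> ptime Mb kb ->
       (exists z, ~ accepts O Ma z /\ ~ accepts O Mb z) \/
       (exists p, (forall n, splits O p n) /\
          forall M k, ptime M k -> deterministic M ->
          exists n z, computes O M (nseq n false) z /\ misreduced O p n Ma Mb z)].
Proof.
have [E E_onto] := machine_enum.
(* The first component is a dummy that makes every task recur at arbitrarily late stages; one tuple
   carries the machines for all three kinds of requirement. *)
pose task := (nat * (nat * nat) * (nat * nat) * nat)%type.
pose task_of t : task := odflt (0, (0, 0), (0, 0), 0) (unpickle t).
pose good (x : task) s s' := let: (_, (i, ka), (j, kb), p) := x in
  [/\ ok s', le_state s s', frozen s < frozen s' & stage_met s s' (E i) ka (E j) kb p].
have next t (s : {s | ok s}) : {s' : {s | ok s} | good (task_of t) (sval s) (sval s')}.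
  apply: constructive_indefinite_description.
  rewrite /good; case: (task_of t) => [[[i [a ka]] [b kb]] p]; case: s => s oks /=.
  have [s' [ok' le' lt' met']] := stage_step (E a) ka (E b) kb p oks.
  by exists (exist _ s' ok').
pose fix seq t : {s | ok s} := if t is t'.+1 then sval (next t' (seq t')) else exist _ _ ok_initial.
pose st t := sval (seq t).
have ok_st t : ok (st t) by apply: (svalP (seq t)).
have good_st t : good (task_of t) (st t) (st t.+1) by apply: (svalP (next t (seq t))).
have le_st1 t : le_state (st t) (st t.+1) /\ frozen (st t) < frozen (st t.+1).
  by move: (good_st t); rewrite /good; case: (task_of t) => [[[i [a ka]] [b kb]] p] [].
have le_st t t' : t <= t' -> le_state (st t) (st t').
  move/subnKC <-; elim: (t' - t) => [|d IHd]; first by rewrite addn0; apply: le_state_refl.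
  by rewrite addnS; apply: le_state_trans IHd (le_st1 _).1.
have frozen_st t : t <= frozen (st t).
  by elim: t => // t IHt; apply: leq_ltn_trans IHt (le_st1 t).2.
(* Stage [t] has frozen at least the lengths below [t], so stage [(size q).+1] has decided [q]. *)
pose O : oracle := fun q => base (st (size q).+1) q.
have bO t : below (st t) O.
  move=> q lt_q; rewrite /O; case: (leqP t (size q).+1) => le_t.
    by case: (le_st _ _ le_t) => _ agD _ _; apply: iff_sym; apply: agD.
  by case: (le_st _ _ (ltnW le_t)) => _ agD _ _; apply: agD; apply: leq_trans (frozen_st _).
(* Stage [maxn t L] has frozen all lengths below [L] and extends stage [t]. *)
have vO t L : valid (st t) O L.
  apply: validW (leq_maxr t L) _; apply: validW (frozen_st _) _.
  apply: valid_le (le_st _ _ (leq_maxl t L)) _.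
  by apply: valid_agree (ok_st _) _ _ (ok_base (ok_st _)); apply: agreeS; apply: bO.
have visit x m : exists t, m <= t /\ exists m', task_of t = (m', x.1.1, x.1.2, x.2).
  pose f i := pickle ((i, x.1.1, x.1.2, x.2) : task).
  have inj_f : injective f by move=> i j /(pcan_inj pickleK)[].
  have [i le_i] : exists i, m <= f i.
    apply: NNPP => none; have lt_f i : f i < m.
      by rewrite ltnNge; apply/negP => le_m; apply: none; exists i.
    have sub : {subset [seq f i | i <- iota 0 m.+1] <= iota 0 m}.
      by move=> _ /mapP[i _ ->]; rewrite mem_iota add0n lt_f.
    have := uniq_leq_size _ sub; rewrite map_inj_uniq // iota_uniq size_map !size_iota ltnn.
    by move/(_ isT).
  by exists (f i); split=> //; exists i; rewrite /task_of /f pickleK.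
exists O; split.
- move=> v m lv; have [_ cod _] := vO 0 (size v + m + 2).
  have [|y [[sz nK _ _] Dy]] := cod v m lv; first by rewrite addn1 addn2.
  by exists y.
- move=> x m le_m nKx; have [_ cod _] := vO 0 (size (tagged_word 0 x) + m + 2).
  have [|y [[sz nK _ sl] Dy]] := cod _ m (last_tagged_word 0 x); first by rewrite addn1 addn2.
  by rewrite -{2}(sl x _).
- move=> M k pM dM; have [i Ei] := E_onto M.
  have [t [_ [m' tE]]] := visit ((i, k), (0, 0), 0) 0.
  have := good_st t; rewrite /good tE /= Ei => -[_ _ _ [tm _ _]].
  have [[e Te]|bad] := tm pM dM; last by left; apply: bad (bO _).
  right; exists e.
    by rewrite lt0n; apply/eqP => e0; move: Te; rewrite e0 (ok_trusted0 (ok_st _)).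
  move=> x m le_m; have [_ cod _] := vO t.+1 (size (tagged_word e x) + m + 2).
  have [|y [[sz _ app _] Dy]] := cod _ m (last_tagged_word e x); first by rewrite addn1 addn2.
  by exists y; split=> //; apply: (app M k); exists e.
- move=> Ma ka Mb kb pa pb; have [i Ei] := E_onto Ma; have [j Ej] := E_onto Mb.
  have [t [_ [m' tE]]] := visit ((i, ka), (j, kb), 0) 0.
  have := good_st t; rewrite /good tE /= Ei Ej => -[_ _ _ [_ am _]].
  have [[p Pp]|bad] := am pa pb; last by left; apply: bad (bO _).
  right; exists p; split=> [n|M k pM dM].
    by have [_ _ spl] := vO t.+1 (p + 3 + n).+1; apply: spl; rewrite ?Pp.
  have [h Eh] := E_onto M.
  (* The pair is active from stage [t.+1] on, so the recurring task for [M] and [p] meets it at a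
     later stage. *)
  have [t' [le_t [m2 tE']]] := visit ((h, k), (0, 0), p) t.+1.
  have := good_st t'; rewrite /good tE' /= Eh => -[_ _ _ [_ _ dm]].
  have [_ _ _ leP] := le_st _ _ le_t.
  exact: dm pM dM _ _ _ _ (leP _ _ Pp) _ (bO _).
Qed.

End Construction.

(** * Programs for Turing machines *)

(* Half-tapes as streams: unlike lists, they do not see trailing blanks. *)
Definition stream := nat -> sym.
Definition blank : stream := fun _ => None.
Definition scons (a : sym) (S : stream) : stream := fun i => if i is i'.+1 then S i' else a.
Definition stail (S : stream) : stream := fun i => S i.+1.
Definition sapp (w : word) (S : stream) : stream := foldr (fun b => scons (Some b)) S w.

Lemma scons_eta S : scons (S 0) (stail S) = S.
Proof. by apply: functional_extensionality => -[|i]. Qed.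

Lemma scons_blank : scons None blank = blank.
Proof. by apply: functional_extensionality => -[|i]. Qed.

Lemma sapp_cat v w S : sapp (v ++ w) S = sapp v (sapp w S).
Proof. by rewrite /sapp foldr_cat. Qed.

Lemma sapp_rcons w b S : sapp (rcons w b) S = sapp w (scons (Some b) S).
Proof. by rewrite -cats1 sapp_cat. Qed.

Definition stape := (stream * sym * stream)%type.

(* Head on the first cell of [S], the rest of the tape, [A], being behind it, for
   a head looking right ([d = true]) or left. *)
Definition facing (d : bool) (A S : stream) : stape :=
  if d then (A, S 0, stail S) else (stail S, S 0, A).

Definition dir (d : bool) := if d then MoveR else MoveL.

Definition smove (mv : move) (t : stape) : stape :=
  let: (L, c, R) := t in
  match mv with
  | MoveL => (stail L, L 0, scons c R)
  | MoveR => (scons c L, R 0, stail R)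
  | Stay => t
  end.

Definition swrite (a : sym) (t : stape) : stape := (t.1.1, a, t.2).

Definition stape_of (t : tape) : stape := (nth None (lft t), cur t, nth None (rgt t)).

Lemma nth_scons a s : nth None (a :: s) = scons a (nth None s).
Proof. by apply: functional_extensionality => -[|i]. Qed.

Lemma nth_blank : nth None [::] = blank.
Proof. by apply: functional_extensionality => i; rewrite nth_nil. Qed.

Lemma stape_of_move mv t : stape_of (move_tape mv t) = smove mv (stape_of t).
Proof.
by case: mv; case: t => [[|a l] c [|b r]] //=; rewrite /stape_of /= ?nth_scons ?nth_blank.
Qed.

Lemma stape_of_write a t : stape_of (write_tape a t) = swrite a (stape_of t).
Proof. by []. Qed.

Lemma stape_of_word x : stape_of (tape_of x) = facing true blank (sapp x blank).
Proof.
rewrite /stape_of; case: x => [|b x] /=; rewrite !nth_blank //.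
rewrite /facing /=; congr (_, _, _).
by elim: x => [|a x IHx] /=; rewrite ?nth_blank // nth_scons IHx.
Qed.

Lemma takebits_stream s y S : nth None s = sapp y (scons None S) -> takebits s = y.
Proof.
elim: y s => [|b y IHy] [|a s] E //; have := congr1 (@^~ 0) E => //= -> //.
by rewrite (IHy s) //; apply: functional_extensionality => i; apply: (congr1 (@^~ i.+1) E).
Qed.

Lemma output_of t A y S :
  stape_of t = facing true A (sapp y (scons None S)) -> output t = y.
Proof.
case: t => l c r [_ c_eq r_eq]; apply: (@takebits_stream _ _ S).
by rewrite nth_scons /= c_eq r_eq scons_eta.
Qed.

Definition emit (w : word) (e : option bool) := if e is Some b then rcons w b else w.

Record action St := Act { a_write : sym; a_move : move; a_emit : option bool; a_to : St }.

(** Control states live in an arbitrary type. [states] has to cover those with a transition, which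
    makes [program] a finite table. *)
Record prog := Prog {
  pstate : Type;
  code : pstate -> nat;
  states : seq pstate;
  delta : pstate -> sym -> seq (action pstate);
  start : pstate; ask : pstate; yes : pstate; no : pstate; acc : pstate;
  code_inj : injective code;
  delta_states : forall q a, delta q a <> [::] -> mem_list q states;
  delta_ask : forall a, delta ask a = [::];
  delta_acc : forall a, delta acc a = [::] }.

Definition program (P : prog) : machine :=
  Machine (flatten [seq [seq Trans (code q.1) q.2 (a_write x) (a_move x) (a_emit x) (code (a_to x))
                        | x <- delta q.1 q.2]
                   | q <- [seq (q, a) | q <- states P, a <- [:: None; Some false; Some true]]])
    (code (start P)) (code (ask P)) (code (yes P)) (code (no P)) (code (acc P)).

Definition answer (D : oracle) w : bool := if excluded_middle_informative (D w) then true else false.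

Lemma answerP D w : reflect (D w) (answer D w).
Proof. by rewrite /answer; case: excluded_middle_informative => Dw; constructor. Qed.

Lemma mem_list_map (T U : Type) (f : T -> U) y s :
  mem_list y (map f s) <-> exists2 x, mem_list x s & f x = y.
Proof.
elim: s => [|a s IHs] /=; first by split=> // -[].
split=> [[<-|/IHs[x sx fx]]|[x [->|sx] fx]]; first by exists a => //; left.
- by exists x => //; right.
- by left.
- by right; apply/IHs; exists x.
Qed.

Lemma mem_list_cat (T : Type) (y : T) s1 s2 :
  mem_list y (s1 ++ s2) <-> mem_list y s1 \/ mem_list y s2.
Proof. by elim: s1 => [|a s1 IHs] /=; tauto. Qed.

Lemma mem_list_flatten (T : Type) (y : T) ss :
  mem_list y (flatten ss) <-> exists2 s, mem_list s ss & mem_list y s.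
Proof.
elim: ss => [|s ss IHs] /=; first by split=> // -[].
rewrite mem_list_cat; split=> [[ys|/IHs[s' ss' ys']]|[s' [->|ss'] ys']].
- by exists s => //; left.
- by exists s' => //; right.
- by left.
- by right; apply/IHs; exists s'.
Qed.

Lemma mem_list_iota i n : i < n -> mem_list i (iota 0 n).
Proof.
move=> lt_i; have : i \in iota 0 n by rewrite mem_iota.
by elim: (iota 0 n) => //= j s IHs; rewrite inE => /orP[/eqP->|/IHs]; [left | right].
Qed.

Section Programs.
Variable P : prog.
Notation program := (program P).
Implicit Types (q : pstate P).

Lemma program_trans tr : mem_list tr (m_trans program) <-> exists q a x,
  mem_list x (delta q a) /\ tr = Trans (code q) a (a_write x) (a_move x) (a_emit x) (code (a_to x)).
Proof.
rewrite mem_list_flatten; split=> [[s /mem_list_map[[q a] _ <-] /mem_list_map[x qx <-]]|].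
  by exists q, a, x.
case=> q [a [x [qx ->]]].
exists [seq Trans (code q) a (a_write x) (a_move x) (a_emit x) (code (a_to x)) | x <- delta q a].
  apply/mem_list_map; exists (q, a) => //; apply/mem_list_flatten.
  exists [seq (q, a) | a <- [:: None; Some false; Some true]].
    by apply/mem_list_map; exists q => //; apply: (@delta_states _ _ a); case: (delta q a) qx.
  by apply/mem_list_map; exists a => //; case: a {qx} => [[]|] /=; tauto.
by apply/mem_list_map; exists x.
Qed.

Lemma step_program D q c c' : c_state c = code q -> code q <> code (ask P) ->
  (step D program c c' <-> exists x, mem_list x (delta q (cur (c_tape c))) /\
   c' = Config (code (a_to x)) (move_tape (a_move x) (write_tape (a_write x) (c_tape c)))
               (emit (c_query c) (a_emit x))).
Proof.
move=> sc nask; split.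
  case=> [[sa _]|[_ [_ [tr [/program_trans[q' [a [x [qx ->]]]]]]]]]; first by case: nask; rewrite -sc.
  rewrite sc /= => -[/code_inj q'q [a_cur [s' [t' w']]]]; exists x; rewrite -q'q -a_cur; split=> //.
  by case: c' s' t' w' => s' t' w' /= -> -> ->.
case=> x [qx ->]; right; split; first by rewrite sc.
split; first by rewrite sc => /code_inj qacc; rewrite qacc delta_acc in qx.
eexists; split; first by apply/program_trans; exists q, (cur (c_tape c)), x.
by [].
Qed.

Lemma program_deterministic : (forall q a, size (delta q a) <= 1) -> deterministic program.
Proof.
move=> det D c c1 c2.
have [ask_c|nask] := eqVneq (c_state c) (code (ask P)).
  have eqc c' c'' : c_state c' = c_state c'' -> c_tape c' = c_tape c'' ->
      c_query c' = c_query c'' -> c' = c'' by case: c'; case: c'' => /= ? ? ? ? ? ? -> -> ->.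
  case=> [[_ [t1 [w1 s1]]]|[]//] [[_ [t2 [w2 s2]]]|[]//].
  apply: eqc; rewrite ?t1 ?t2 ?w1 ?w2 //.
  by case: s1 s2 => [[? ->]|[? ->]] [[? ->]|[? ->]].
case=> [[sa _]|]; first by rewrite sa eqxx in nask.
case=> _ [_ [tr1 [/program_trans[q1 [a1 [x1 [qx1 ->]]]] [/= sq1 [sa1 [s1 [t1 w1]]]]]]].
case=> [[sa _]|]; first by rewrite sa eqxx in nask.
case=> _ [_ [tr2 [/program_trans[q2 [a2 [x2 [qx2 ->]]]] [/= sq2 [sa2 [s2 [t2 w2]]]]]]].
have q12 : q1 = q2 by apply: code_inj; rewrite sq1.
move: qx1 qx2 (det q1 a1) s1 t1 w1 s2 t2 w2; rewrite -q12 sa1 -sa2.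
case: (delta q1 a2) => [|x [|]] //= [<-|//] [<-|//] _.
by case: c1; case: c2 => /= ? ? ? ? ? ? -> -> -> -> -> ->.
Qed.

Definition represents (c : config) q (t : stape) (w : word) :=
  [/\ c_state c = code q, stape_of (c_tape c) = t & c_query c = w].

Definition run D b q t w q' t' w' := forall c, represents c q t w ->
  exists n c', [/\ n <= b, steps D program n c c' & represents c' q' t' w'].

Lemma run_refl D q t w : run D 0 q t w q t w.
Proof. by move=> c rc; exists 0, c. Qed.

Lemma run_trans D b1 b2 q1 t1 w1 q2 t2 w2 q3 t3 w3 :
  run D b1 q1 t1 w1 q2 t2 w2 -> run D b2 q2 t2 w2 q3 t3 w3 -> run D (b1 + b2) q1 t1 w1 q3 t3 w3.
Proof.
move=> r12 r23 c1 /r12[n1 [c2 [le1 s1 /r23[n2 [c3 [le2 s2 rc3]]]]]].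
by exists (n1 + n2), c3; split=> //; [exact: leq_add | exact: steps_cat s1 s2].
Qed.

Lemma runW D b b' q t w q' t' w' : b <= b' -> run D b q t w q' t' w' -> run D b' q t w q' t' w'.
Proof.
by move=> le_b r c /r[n [c' [le_n s rc]]]; exists n, c'; split=> //; apply: leq_trans le_b.
Qed.

Lemma run_choice D q t w a mv e q' : mem_list (Act a mv e q') (delta q t.1.2) ->
  run D 1 q t w q' (smove mv (swrite a t)) (emit w e).
Proof.
move=> qE c [sc tc wc]; exists 1; eexists; split=> //.
  eexists; split; last by [].
  have nask : code q <> code (ask P) by move/code_inj=> qa; rewrite qa delta_ask in qE.
  apply/(step_program D _ sc nask).
  have -> : cur (c_tape c) = t.1.2 by rewrite -tc.
  by exists (Act a mv e q').
by split=> //=; rewrite ?stape_of_move ?stape_of_write ?tc ?wc.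
Qed.

Lemma run_act D q t w a mv e q' : delta q t.1.2 = [:: Act a mv e q'] ->
  run D 1 q t w q' (smove mv (swrite a t)) (emit w e).
Proof. by move=> qE; apply: run_choice; rewrite qE; left. Qed.

Lemma run_stay D d q A s S w a e q' : delta q s = [:: Act a Stay e q'] ->
  run D 1 q (facing d A (scons s S)) w q' (facing d A (scons a S)) (emit w e).
Proof.
have := @run_act D q (facing d A (scons s S)) w a Stay e q'.
by case: d => H qE; apply: H.
Qed.

Lemma run_fwd D d q A s S w a e q' : delta q s = [:: Act a (dir d) e q'] ->
  run D 1 q (facing d A (scons s S)) w q' (facing d (scons a A) S) (emit w e).
Proof.
have := @run_act D q (facing d A (scons s S)) w a (dir d) e q'.
by case: d => H qE; apply: H.
Qed.

Lemma run_back D d q A s S w a e q' : delta q s = [:: Act a (dir (~~ d)) e q'] ->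
  run D 1 q (facing d A (scons s S)) w q' (facing (~~ d) (scons a S) A) (emit w e).
Proof.
have := @run_act D q (facing d A (scons s S)) w a (dir (~~ d)) e q'.
by case: d => H qE; apply: H.
Qed.

Lemma run_scan D d q em v A S w :
  (forall b, delta q (Some b) = [:: Act (Some b) (dir d) (em b) q]) ->
  run D (size v) q (facing d A (sapp v S)) w q (facing d (sapp (rev v) A) S) (w ++ pmap em v).
Proof.
move=> qE; elim: v A w => [|b v IHv] A w /=; first by rewrite cats0; apply: run_refl.
rewrite -add1n; eapply run_trans; first exact: run_fwd (qE b).
rewrite rev_cons sapp_rcons.
have -> : w ++ oapp (cons^~ (pmap em v)) (pmap em v) (em b) = emit w (em b) ++ pmap em v.
  by case: (em b) => //= b'; rewrite cat_rcons.
exact: IHv.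
Qed.

Lemma run_ask D t w :
  run D 1 (ask P) t w (if answer D w then yes P else no P) t [::].
Proof.
move=> c [sc tc wc]; exists 1, (Config (code (if answer D w then yes P else no P)) (c_tape c) [::]).
split=> //; eexists; split; last by [].
left; do 3!split=> //; rewrite wc.
by case: (answerP D w) => Dw; [left | right].
Qed.

Definition halting q (t : stape) := code q <> code (ask P) /\ delta q t.1.2 = [::].

Lemma represents_halting D c q t w : represents c q t w -> halting q t ->
  forall c', ~ step D program c c'.
Proof.
case=> sc <- _ [nask q_end] c' /(step_program D c' sc nask)[x [qx _]].
by rewrite /= in q_end; rewrite q_end in qx.
Qed.

Lemma step_represents D c c' q t w : represents c q t w -> code q <> code (ask P) ->
  step D program c c' -> exists x, mem_list x (delta q t.1.2) /\
    represents c' (a_to x) (smove (a_move x) (swrite (a_write x) t)) (emit w (a_emit x)).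
Proof.
case=> sc tc wc nask /(step_program D c' sc nask)[x [qx ->]]; exists x.
split; first by rewrite -tc.
by split=> //=; rewrite ?stape_of_move ?stape_of_write ?tc ?wc.
Qed.

Lemma step_represents_ask D c c' t w : represents c (ask P) t w -> step D program c c' ->
  (D w /\ represents c' (yes P) t [::]) \/ (~ D w /\ represents c' (no P) t [::]).
Proof.
case=> sc tc wc [[_ [tc' [wc' [[Dw sc']|[Dw sc']]]]]|[[]//]]; rewrite wc in Dw.
  by left; split=> //; split=> //; rewrite tc'.
by right; split=> //; split=> //; rewrite tc'.
Qed.

Lemma represents_init x : represents (init program x) (start P) (facing true blank (sapp x blank)) [::].
Proof. by split=> //; apply: stape_of_word. Qed.

Lemma run_computes D b x q A y S w :
  run D b (start P) (facing true blank (sapp x blank)) [::] q (facing true A (sapp y (scons None S))) w ->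
  halting q (facing true A (sapp y (scons None S))) -> computes D program x y.
Proof.
move=> /(_ _ (represents_init x))[n [c [_ s rc]]] hq; exists n, c; split=> //; split.
  exact: represents_halting rc hq.
by case: rc => _ /output_of->.
Qed.

(** By determinism no run outlasts the halting one, so one halting run per input and oracle gives
    the time bound. *)
Lemma run_ptime b : (forall q a, size (delta q a) <= 1) -> poly_bounded b ->
  (forall D x, exists q t w, run D (b (size x)) (start P) (facing true blank (sapp x blank)) [::] q t w
     /\ halting q t) ->
  exists k, ptime program k.
Proof.
move=> /program_deterministic det /poly_ptime[k Hk] total; exists k => D x c Hc.
have [q [t [w [/(_ _ (represents_init x))[n [c' [le_n s rc]]] hq]]]] := total D x.
have := steps_halted det s (represents_halting rc hq) Hc.
by rewrite ltnNge (leq_trans le_n (Hk _)).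
Qed.

End Programs.

(** * Guessing a string of the oracle *)

Section Guess.
Variable c : word.

Variant guess_state := GEmit of nat | GAsk | GYes | GNo.

Definition guess_code q := match q with GEmit i => i + 3 | GAsk => 0 | GYes => 1 | GNo => 2 end.

(** The constant prefix [c] is emitted first, then one guessed bit per input cell, then the closing
    [true]; a positive answer accepts. *)
Definition guess_delta q (a : sym) : seq (action guess_state) :=
  if q is GEmit i then
    if i < size c then [:: Act a Stay (Some (nth false c i)) (GEmit i.+1)]
    else if i == size c then
      if a is Some _ then
        [:: Act a MoveR (Some false) (GEmit i); Act a MoveR (Some true) (GEmit i)]
      else [:: Act None Stay (Some true) GAsk]
    else [::]
  else [::].

Lemma guess_code_inj : injective guess_code.
Proof. by case=> [i|||] [j|||] //=; rewrite ?addn3 // => -[->]. Qed.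

Lemma guess_states q a : guess_delta q a <> [::] -> mem_list q (map GEmit (iota 0 (size c).+1)).
Proof.
case: q => [i|||]; rewrite /guess_delta // => H.
apply/mem_list_map; exists i => //; apply: mem_list_iota.
by rewrite ltnS; move: H; case: ltngtP => // _ [].
Qed.

Definition guess : prog := @Prog guess_state guess_code (map GEmit (iota 0 (size c).+1)) guess_delta
  (GEmit 0) GAsk GYes GNo GYes guess_code_inj guess_states (fun _ => erefl) (fun _ => erefl).

Lemma guess_query D n A x w conf conf' :
  represents (P := guess) conf (GEmit (size c)) (facing true A (sapp x blank)) w ->
  steps D (program guess) n conf conf' -> n <= size x + 2 /\
  (c_state conf' = guess_code GYes -> exists y, size y = size x /\ D (w ++ rcons y true)).
Proof.
have dead q : q = GYes \/ q = GNo -> forall t v c1 m c2,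
    represents (P := guess) c1 q t v -> steps D (program guess) m c1 c2 -> m = 0 /\ c1 = c2.
  move=> qE t v c1 [|m] c2 rc1 //= [c3 [c13 _]].
  have hq : halting (P := guess) q t by case: qE => ->; split.
  by case: (represents_halting rc1 hq c13).
have nask : @code guess (GEmit (size c)) <> code (ask guess) by rewrite /= addn3.
elim: x n A w conf => [|b x IHx] [|n] A w conf rc /=; try by move=> <-; case: rc => -> /= _ _; rewrite addn3.
  case=> c1 [/(step_represents rc nask)[a []]]; rewrite /= ltnn eqxx => -[<-|//] /= rc1.
  case: n => [|n] /=; first by move=> <-; case: rc1 => ->.
  case=> c2 [/(step_represents_ask rc1)[[Dw rc2]|[Dw rc2]]] /(dead _ _ _ _ _ _ _ rc2)[]; try tauto.
    by move=> -> _; split=> // _; exists [::]; split; rewrite // cats1.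
  by move=> -> <-; split=> //; case: rc2 => ->.
case=> c1 [/(step_represents rc nask)[a []]]; rewrite /= ltnn eqxx.
case=> [<-|[<-|//]] /= rc1 /(IHx _ _ _ _ rc1)[le_n acc]; (split; first lia) => /acc[y [sy Dy]].
  by exists (false :: y); rewrite /= sy -cat_rcons.
by exists (true :: y); rewrite /= sy -cat_rcons.
Qed.

Lemma guess_steps D n k A x conf conf' : k <= size c ->
  represents (P := guess) conf (GEmit (size c - k)) (facing true A (sapp x blank)) (take (size c - k) c) ->
  steps D (program guess) n conf conf' -> n <= k + size x + 2 /\
  (c_state conf' = guess_code GYes -> exists y, size y = size x /\ D (c ++ rcons y true)).
Proof.
elim: k n conf => [|k IHk] n conf le_k.
  by rewrite subn0 take_size; apply: guess_query.
have nask : @code guess (GEmit (size c - k.+1)) <> code (ask guess) by rewrite /= addn3.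
case: n => [|n] rc /=; first by move=> <-; case: rc => -> /= _ _; rewrite addn3.
case=> c1 [/(step_represents rc nask)[a []]]; rewrite /= ltn_subrL (leq_trans _ le_k) //=.
case=> [<-|//] /= rc1 /(IHk _ _ (ltnW le_k)) H; have [|le_n acc] := H; last by split=> //; lia.
have lt_k : size c - k.+1 < size c by lia.
by move: rc1; rewrite /swrite -take_nth // -subSn // subSS.
Qed.

Lemma guess_ptime : exists k, ptime (program guess) k.
Proof.
have [k Hk] := poly_ptime (poly_add (poly_const (size c + 2)) poly_id).
exists k => D x conf Hn.
have rc := represents_init guess x.
have := @guess_steps D (size x ^ k + k).+1 (size c) blank x _ conf (leqnn _).
rewrite subnn take0 => /(_ _ rc Hn)[+ _]; have := Hk (size x); rewrite /=; lia.
Qed.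

Lemma guess_accepts D x : accepts D (program guess) x <->
  exists y, size y = size x /\ D (c ++ rcons y true).
Proof.
have rc := represents_init guess x; split.
  case=> _ [n [conf [_ [Hn acc_c]]]].
  have := @guess_steps D n (size c) blank x _ conf (leqnn _).
  by rewrite subnn take0 => /(_ _ rc Hn)[_]; apply.
case=> y [sy Dy].
have emit_run k : k <= size c -> run (P := guess) D k (GEmit 0) (facing true blank (sapp x blank)) [::]
    (GEmit k) (facing true blank (sapp x blank)) (take k c).
  elim: k => [|k IHk] lt_k; first by rewrite take0; apply: run_refl.
  rewrite -addn1; apply: run_trans (IHk (ltnW lt_k)) _; rewrite addn1 (take_nth false) //.
  have := @run_stay guess D true (GEmit k) blank _ (stail (sapp x blank)) (take k c) _
    (Some (nth false c k)) (GEmit k.+1).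
  by move=> /(_ (sapp x blank 0) (sapp x blank 0)); rewrite scons_eta; apply; rewrite /= lt_k.
have scan_run A w : run (P := guess) D (size x) (GEmit (size c)) (facing true A (sapp x blank)) w
    (GEmit (size c)) (facing true (sapp (rev x) A) blank) (w ++ y).
  elim: x y sy A w {Dy rc emit_run} => [|b x IHx] [|d y] //= sy A w.
    by rewrite cats0; apply: run_refl.
  rewrite -add1n -cat_rcons rev_cons sapp_rcons; apply: run_trans; last first.
    by apply: IHx; case: sy.
  have := @run_choice guess D (GEmit (size c)) (facing true A (scons (Some b) (sapp x blank))) w
    (Some b) MoveR (Some d) (GEmit (size c)).
  by apply; rewrite /= ltnn eqxx; case: d {sy} => /=; tauto.
have ask_run A w : D (rcons w true) -> run (P := guess) D 2 (GEmit (size c)) (facing true A blank) w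
    GYes (facing true A blank) [::].
  move=> Dw; have := @run_ask guess D (facing true A blank) (rcons w true).
  have -> : answer D (rcons w true) by apply/answerP.
  apply: (@run_trans guess D 1 1); rewrite -scons_blank.
  have := @run_stay guess D true (GEmit (size c)) A None blank w None (Some true) GAsk.
  by apply; rewrite /= ltnn eqxx.
have := run_trans (emit_run _ (leqnn _)) (run_trans (scan_run _ _) (ask_run _ _ _)).
rewrite take_size rcons_cat => /(_ Dy _ rc)[n [conf [le_n Hn [sconf _ _]]]].
by exists n, n, conf.
Qed.

End Guess.

(** * The decoder *)

(* [DLeft]/[DRight] scan the output region and the input while building the query,
   [DEnd] erases the last input bit, [DBack]/[DWrite] carry the answer to the left
   end of the output region, [DSkip]/[DTrim]/[DHome] finally remove the padding. *)
Variant decode_state :=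
  DStart | DLeft | DRight | DEnd | DAsk | DYes | DNo | DBack of bool | DWrite of bool |
  DSkip | DTrim | DHome | DHalt | DAcc.

Definition decode_code q : nat :=
  match q with
  | DStart => 0 | DLeft => 1 | DRight => 2 | DEnd => 3 | DAsk => 4 | DYes => 5 | DNo => 6
  | DSkip => 7 | DTrim => 8 | DHome => 9 | DHalt => 10 | DAcc => 11
  | DBack b => 12 + b | DWrite b => 14 + b
  end.

Definition decode_delta q (a : sym) : seq (action decode_state) :=
  match q, a with
  | DStart, _ => [:: Act a MoveL None DLeft]
  | DLeft, Some _ => [:: Act a MoveR (Some true) DLeft]
  | DLeft, None => [:: Act a MoveR (Some false) DRight]
  | DRight, Some b => [:: Act a MoveR (Some b) DRight]
  | DRight, None => [:: Act a MoveL None DEnd]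
  | DEnd, Some false => [:: Act None Stay None DAsk]
  | DEnd, _ => [:: Act a Stay None DSkip]
  | DYes, None => [:: Act a MoveL None (DBack true)]
  | DNo, None => [:: Act a MoveL None (DBack false)]
  | DBack b, Some _ => [:: Act a MoveL None (DBack b)]
  | DBack b, None => [:: Act a MoveL None (DWrite b)]
  | DWrite b, Some _ => [:: Act a MoveL None (DWrite b)]
  | DWrite b, None => [:: Act (Some b) Stay None DLeft]
  | DSkip, Some _ => [:: Act a MoveL None DSkip]
  | DSkip, None => [:: Act a MoveL None DTrim]
  | DTrim, Some false => [:: Act None MoveL None DTrim]
  | DTrim, Some true => [:: Act None MoveL None DHome]
  | DHome, Some _ => [:: Act a MoveL None DHome]
  | DHome, None => [:: Act a MoveR None DHalt]
  | _, _ => [::]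
  end.

Definition decode_states :=
  [:: DStart; DLeft; DRight; DEnd; DYes; DNo; DBack true; DBack false; DWrite true; DWrite false;
      DSkip; DTrim; DHome].

Lemma decode_code_inj : injective decode_code.
Proof. by case=> [|||||||[]|[]|||||] [|||||||[]|[]|||||]. Qed.

Lemma decode_statesP q a : decode_delta q a <> [::] -> mem_list q decode_states.
Proof. by case: q => [|||||||[]|[]|||||] //=; tauto. Qed.

Definition decoder : prog := @Prog decode_state decode_code decode_states decode_delta
  DStart DAsk DYes DNo DAcc decode_code_inj decode_statesP (fun _ => erefl) (fun _ => erefl).

(** Inverse of [enc]; a string without [true] decodes to the empty word. *)
Definition decode_bits (a : word) : word := rev (drop (index true a).+1 a).

Definition answers (D : oracle) v m j := mkseq (fun i => answer D (code_query v m i)) j.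

Local Notation drun := (run (P := decoder)).

Lemma decode_trim D a B w : exists q A' B',
  drun D (2 * size a + 2) DTrim (facing false B (sapp a blank)) w
    q (facing true A' (sapp (decode_bits a) (scons None B'))) w /\
  halting (P := decoder) q (facing true A' (sapp (decode_bits a) (scons None B'))).
Proof.
elim: a B => [|[] a IHa] B.
- exists DTrim, blank, B; split; last by split.
  exact: runW _ (@run_refl _ _ _ _ _).
- exists DHalt, blank, B; split; last by split.
  apply: (@runW _ _ (1 + (size a + 1))); first by rewrite /=; lia.
  rewrite /decode_bits /= drop0.
  apply: run_trans; first exact: (@run_fwd decoder D false DTrim B (Some true) _ w None None DHome).
  apply: run_trans.
    exact: (@run_scan decoder D false DHome (fun _ => None) a (scons None B) blank w).
  have -> : w ++ pmap (fun _ => None) a = w by elim: a {IHa} => [|b a]; rewrite ?cats0.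
  rewrite -{1}scons_blank.
  have := @run_back decoder D false DHome (sapp (rev a) (scons None B)) None blank w None None DHalt erefl.
  by rewrite scons_blank.
have [q [A' [B' [r h]]]] := IHa (scons None B); exists q, A', B'; split=> //.
apply: (@runW _ _ (1 + (2 * size a + 2))); first by rewrite /=; lia.
apply: run_trans r.
exact: (@run_fwd decoder D false DTrim B (Some false) _ w None None DTrim).
Qed.

Lemma pmap_none (v w : word) : w ++ pmap (fun _ => None) v = w :> word.
Proof. by elim: v => [|b v]; rewrite ?cats0. Qed.

(** The output region [z] holds one cell per bit already read, so scanning it emits the index of the
    next bit in unary. *)
Lemma decode_query D z v : drun D (size z + size v + 2) DLeft
  (facing true blank (sapp z (scons None (sapp v blank)))) [::]
  DEnd (facing false blank (sapp (rev v) (scons None (sapp (rev z) blank))))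
  (nseq (size z) true ++ false :: v).
Proof.
apply: (@runW _ _ (size z + (1 + (size v + 1)))); first by lia.
apply: run_trans; first exact: (@run_scan decoder D true DLeft (fun _ => Some true)).
apply: run_trans; first exact: (@run_fwd decoder D true DLeft _ _ _ _ _ (Some false) DRight).
apply: run_trans; first exact: (@run_scan decoder D true DRight (fun b => Some b)).
have -> : emit ([::] ++ pmap (fun _ => Some true) z) (Some false) ++ pmap (fun b => Some b) v =
    nseq (size z) true ++ false :: v.
  rewrite /= cat_rcons; congr (_ ++ _ :: _); first by elim: z => //= b z ->.
  by elim: v => //= b v ->.
rewrite -{2}scons_blank.
have := @run_back decoder D true DRight (sapp (rev v) (scons None (sapp (rev z) blank))) None blank
  (nseq (size z) true ++ false :: v) None None DEnd erefl.
by rewrite scons_blank.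
Qed.

Lemma decode_carry D z v b w : drun D (size v + size z + 2) (DBack b)
  (facing false blank (sapp (rev v) (scons None (sapp (rev z) blank)))) w
  DLeft (facing true blank (sapp (b :: z) (scons None (sapp v blank)))) w.
Proof.
apply: (@runW _ _ (size (rev v) + (1 + (size (rev z) + 1)))); first by rewrite !size_rev; lia.
apply: run_trans; first exact: (@run_scan decoder D false (DBack b) (fun _ => None)).
apply: run_trans; first exact: (@run_fwd decoder D false (DBack b) _ _ _ _ _ None (DWrite b)).
apply: run_trans; first exact: (@run_scan decoder D false (DWrite b) (fun _ => None)).
rewrite /= !pmap_none !revK -{2}scons_blank.
have := @run_stay decoder D false (DWrite b) (sapp z (scons None (sapp v blank))) None blank w
  (Some b) None DLeft erefl.
exact.
Qed.

(** One zero of padding is erased per round, which counts the rounds; this is why [code_query]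
    carries only [m - j] zeros. *)
Lemma decode_round D z v : drun D (2 * (size z + size v) + 8) DLeft
  (facing true blank (sapp z (scons None (sapp (rcons v false) blank)))) [::]
  DLeft (facing true blank (sapp (answer D (nseq (size z) true ++ false :: rcons v false) :: z)
                               (scons None (sapp v blank)))) [::].
Proof.
set q := nseq _ _ ++ _.
apply: (@runW _ _ (size z + size (rcons v false) + 2 + (1 + (1 + (1 + (size v + size z + 2)))))).
  by rewrite size_rcons; lia.
apply: run_trans; first exact: decode_query.
rewrite rev_rcons -/q /=.
apply: run_trans; first exact: (@run_stay decoder D false DEnd _ _ _ _ _ None DAsk).
apply: run_trans; first exact: run_ask.
apply: run_trans; last exact: decode_carry.
rewrite -{3}scons_blank.
by case: (answer D q); [exact: (@run_fwd decoder D false DYes _ _ _ _ _ None (DBack true)) |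
  exact: (@run_fwd decoder D false DNo _ _ _ _ _ None (DBack false))].
Qed.

Lemma decode_rounds D v m j : j <= m ->
  drun D (j * (2 * (size v + m) + 8)) DLeft
    (facing true blank (scons None (sapp (v ++ nseq m false) blank))) [::]
    DLeft (facing true blank (sapp (rev (answers D v m j))
                             (scons None (sapp (v ++ nseq (m - j) false) blank)))) [::].
Proof.
elim: j => [|j IHj] lt_j; first by rewrite subn0; apply: run_refl.
rewrite mulSn addnC; apply: run_trans (IHj (ltnW lt_j)) _.
have mE : v ++ nseq (m - j) false = rcons (v ++ nseq (m - j.+1) false) false.
  by rewrite -cats1 -catA -[[:: false]]/(nseq 1 false) -nseqD; congr (_ ++ nseq _ _); lia.
have := @decode_round D (rev (answers D v m j)) (v ++ nseq (m - j.+1) false).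
rewrite -mE size_rev size_mkseq -/(code_query v m j) /answers mkseqS rev_rcons.
by apply: runW; rewrite size_cat size_nseq; lia.
Qed.

Lemma decode_end D v z : last true v -> exists q A B w,
  drun D (4 * (size v + size z) + 8) DLeft
    (facing true blank (sapp (rev z) (scons None (sapp v blank)))) [::]
    q (facing true A (sapp (decode_bits z) (scons None B))) w /\
  halting (P := decoder) q (facing true A (sapp (decode_bits z) (scons None B))).
Proof.
move=> lv; set w := nseq (size (rev z)) true ++ false :: v.
have [q [A [B [r h]]]] := decode_trim D z (scons None (sapp v blank)) w.
exists q, A, B, w; split=> //.
apply: (@runW _ _ (size (rev z) + size v + 2 + (1 + (size (rev v) + (1 + (2 * size z + 2)))))).
  by rewrite !size_rev; lia.
apply: run_trans; first exact: decode_query.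
rewrite -/w revK.
apply: run_trans.
  (* Either [v] is empty and a blank is read, or its last bit is [true]; in both cases no query is
     made. *)
  have : decode_delta DEnd (sapp (rev v) (scons None (sapp z blank)) 0) =
      [:: Act (sapp (rev v) (scons None (sapp z blank)) 0) Stay None DSkip].
    by case/lastP: v lv {w r} => [|v b]; rewrite ?last_rcons ?rev_rcons //= => ->.
  rewrite -{1}[sapp (rev v) _]scons_eta; exact: (@run_stay decoder D false).
rewrite scons_eta.
apply: run_trans; first exact: (@run_scan decoder D false DSkip (fun _ => None)).
rewrite revK pmap_none; apply: run_trans r.
exact: (@run_fwd decoder D false DSkip _ _ _ _ _ None DTrim).
Qed.

Lemma decode_run D v m : last true v -> exists q A B w,
  drun D (((size v + m).+1 + 1) * (4 * (size v + m) + 8)) DStart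
    (facing true blank (sapp (v ++ nseq m false) blank)) [::]
    q (facing true A (sapp (decode_bits (answers D v m m)) (scons None B))) w /\
  halting (P := decoder) q (facing true A (sapp (decode_bits (answers D v m m)) (scons None B))).
Proof.
move=> lv; have [q [A [B [w [r h]]]]] := decode_end D (answers D v m m) lv.
exists q, A, B, w; split=> //.
apply: (@runW _ _ (1 + (m * (2 * (size v + m) + 8) + (4 * (size v + size (answers D v m m)) + 8)))).
  by rewrite size_mkseq; nia.
apply: run_trans; last first.
  by have := @decode_rounds D v m m (leqnn m); rewrite subnn cats0 => r'; apply: run_trans r' r.
have := @run_back decoder D true DStart blank (sapp (v ++ nseq m false) blank 0)
  (stail (sapp (v ++ nseq m false) blank)) [::] _ None DLeft erefl.
by rewrite scons_eta.
Qed.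

Lemma decoder_det : deterministic (program decoder).
Proof. by apply: program_deterministic => -[|||||||b|b|||||] [[]|]. Qed.

Lemma decoder_ptime : exists k, ptime (program decoder) k.
Proof.
have p1 : poly_bounded (fun n => n.+1 + 1).
  by apply: poly_le (poly_add poly_id (poly_const 2)) => n; rewrite /=; lia.
have p2 := poly_add (poly_mul (poly_const 4) poly_id) (poly_const 8).
apply: (run_ptime _ (poly_mul p1 p2)); first by case=> [|||||||b|b|||||] [[]|].
move=> D x; have [v [m [lv ->]]] := trailing_decomp x.
have [q [A [B [w [r h]]]]] := decode_run D m lv.
exists q; eexists; exists w; split; last exact: h.
by rewrite size_cat size_nseq; exact: r.
Qed.

Lemma decoder_computes D v m : last true v ->
  computes D (program decoder) (v ++ nseq m false) (decode_bits (answers D v m m)).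
Proof. by move=> lv; have [q [A [B [w [r h]]]]] := decode_run D m lv; apply: run_computes r h. Qed.

Lemma decode_codes D v m y : size y < m \/ y = [::] -> codes D v m y ->
  decode_bits (answers D v m m) = y.
Proof.
move=> sz Dy.
have -> : answers D v m m = take m (enc m y).
  apply: (@eq_from_nth _ false).
    by rewrite size_mkseq size_takel // /enc size_cat size_nseq /= size_rev; lia.
  move=> j; rewrite size_mkseq => lt_j; rewrite nth_mkseq // nth_take //.
  by apply/answerP/idP => /(Dy _ lt_j).
(* For [m = 0] no bit is read and [y] is empty; otherwise [enc m y] has length exactly [m]. *)
case: m sz {Dy} => [|m] sz; first by rewrite take0; case: sz => // ->.
have -> : take m.+1 (enc m.+1 y) = enc m.+1 y.
  apply: take_oversize; rewrite /enc size_cat size_nseq /= size_rev.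
  by case: sz => [|->] /=; lia.
rewrite /enc /decode_bits; elim: (_ - _) => /= [|r IHr]; last exact: IHr.
by rewrite drop0 revK.
Qed.

(** * Polynomial padding *)

Local Notation zs n := (nseq n false).

Lemma rev_zs n : rev (zs n) = zs n.
Proof. exact: rev_nseq. Qed.

Section Padder.
Variables (e h : nat).

(* Block [i] multiplies a unary counter by the length of the word [u] between two
   blanks: for each cell erased from the counter on one side of [u], it copies the
   length of [u] to the other side; even blocks work rightwards, odd ones leftwards. *)
Variant pad_state :=
  PStart | PTag of nat | PSeed | POut of nat | PTake of nat | PThru of nat | PMark of nat |
  PFar of nat & bool | PApp of nat & bool | PRet of nat & bool | PUnmark of nat & bool |
  PRewind of nat | PCross of nat | PHome | PHalt | PAsk.

Definition pad_triple q : nat * nat * bool :=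
  match q with
  | PStart => (0, 0, false) | PTag i => (1, i, false) | PSeed => (2, 0, false)
  | POut i => (3, i, false) | PTake i => (4, i, false) | PThru i => (5, i, false)
  | PMark i => (6, i, false) | PFar i b => (7, i, b) | PApp i b => (8, i, b)
  | PRet i b => (9, i, b) | PUnmark i b => (10, i, b) | PRewind i => (11, i, false)
  | PCross i => (12, i, false) | PHome => (13, 0, false) | PHalt => (14, 0, false)
  | PAsk => (15, 0, false)
  end.

Definition pad_code q : nat := pickle (pad_triple q).

(** The test on [i] keeps the table finite. The last block, [h.*2], is even, so the final counter
    ends up to the right of the word. *)
Definition fwd i a q : seq (action pad_state) :=
  if i <= h.*2 then [:: Act a (dir (~~ odd i)) None q] else [::].
Definition bwd i a q : seq (action pad_state) :=
  if i <= h.*2 then [:: Act a (dir (~~ ~~ odd i)) None q] else [::].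

Definition pad_delta q (a : sym) : seq (action pad_state) :=
  match q, a with
  | PStart, _ => [:: Act a MoveL None (PTag 0)]
  | PTag i, _ => if i <= e then [:: Act (Some (i == 0)) MoveL None (PTag i.+1)]
                 else if i == e.+1 then [:: Act a MoveL None PSeed] else [::]
  | PSeed, _ => [:: Act (Some false) Stay None (POut 0)]
  | POut i, Some _ => bwd i a (POut i)
  | POut i, None => fwd i a (PTake i)
  | PTake i, Some _ => fwd i None (PThru i)
  | PTake i, None => fwd i a (PCross i)
  | PThru i, Some _ => fwd i a (PThru i)
  | PThru i, None => fwd i a (PMark i)
  | PMark i, Some b => fwd i None (PFar i b)
  | PMark i, None => bwd i a (PRewind i)
  | PFar i b, Some _ => fwd i a (PFar i b)
  | PFar i b, None => fwd i a (PApp i b)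
  | PApp i b, Some _ => fwd i a (PApp i b)
  | PApp i b, None => bwd i (Some false) (PRet i b)
  | PRet i b, Some _ => bwd i a (PRet i b)
  | PRet i b, None => bwd i a (PUnmark i b)
  | PUnmark i b, Some _ => bwd i a (PUnmark i b)
  | PUnmark i b, None => fwd i (Some b) (PMark i)
  | PRewind i, Some _ => bwd i a (PRewind i)
  | PRewind i, None => bwd i a (POut i)
  | PCross i, Some _ => fwd i a (PCross i)
  | PCross i, None => if i == h.*2 then bwd i (Some true) PHome else fwd i a (POut i.+1)
  | PHome, Some _ => [:: Act a MoveL None PHome]
  | PHome, None => [:: Act a MoveR None PHalt]
  | _, _ => [::]
  end.

Definition block_states i :=
  [:: POut i; PTake i; PThru i; PMark i; PFar i false; PFar i true; PApp i false; PApp i true;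
      PRet i false; PRet i true; PUnmark i false; PUnmark i true; PRewind i; PCross i].

Definition pad_states :=
  [:: PStart, PSeed, PHome & map PTag (iota 0 e.+2)
                           ++ flatten (map block_states (iota 0 h.*2.+1))].

Lemma pad_code_inj : injective pad_code.
Proof.
move=> q q' /(pcan_inj pickleK).
by case: q => [|i||i|i|i|i|i b|i b|i b|i b|i|i|||]; case: q' => //= *; congruence.
Qed.

Lemma pad_statesP q a : pad_delta q a <> [::] -> mem_list q pad_states.
Proof.
have blocks i : i <= h.*2 -> mem_list q (block_states i) -> mem_list q pad_states.
  move=> le_i qi; do 3!right; apply/mem_list_cat; right; apply/mem_list_flatten.
  by exists (block_states i) => //; apply/mem_list_map; exists i => //; apply: mem_list_iota.
have tags i : i < e.+2 -> q = PTag i -> mem_list q pad_states.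
  move=> lt_i ->; do 3!right; apply/mem_list_cat; left.
  by apply/mem_list_map; exists i => //; apply: mem_list_iota.
case: q blocks tags => [|i||i|i|i|i|i b|i b|i b|i b|i|i|||] /= blocks tags;
  try by [case: a | move=> _; tauto];
  rewrite /fwd /bwd => Hq.
  apply: tags (erefl _); move: Hq; case: (leqP i e) => [le_i _|_]; first by lia.
  by case: eqP => // -> _.
all: apply: (blocks i); last by (tauto || by case: b {Hq blocks tags}; tauto).
all: by move: Hq; case: (leqP i h.*2) => //; case: a => [?|]; try case: eqP.
Qed.

Definition padder : prog := @Prog pad_state pad_code pad_states pad_delta
  PStart PAsk PAsk PAsk PAsk pad_code_inj pad_statesP (fun _ => erefl) (fun _ => erefl).

Notation prun := (run (P := padder)).

Section Block.
Variables (D : oracle) (w : word) (i : nat) (le_i : i <= h.*2).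
Let d := ~~ odd i.

Lemma pad_fwd q A s S a q' : pad_delta q s = fwd i a q' ->
  prun D 1 q (facing d A (scons s S)) w q' (facing d (scons a A) S) w.
Proof. by rewrite /fwd le_i => qE; apply: (@run_fwd padder D d q A s S w a None q' qE). Qed.

Lemma pad_bwd q A s S a q' : pad_delta q s = bwd i a q' ->
  prun D 1 q (facing d A (scons s S)) w q' (facing (~~ d) (scons a S) A) w.
Proof. by rewrite /bwd le_i => qE; apply: (@run_back padder D d q A s S w a None q' qE). Qed.

(* In the primed variants the head looks backwards. *)
Lemma pad_fwd' q A s S a q' : pad_delta q s = fwd i a q' ->
  prun D 1 q (facing (~~ d) A (scons s S)) w q' (facing d (scons a S) A) w.
Proof.
rewrite /fwd le_i => qE; have := @run_back padder D (~~ d) q A s S w a None q'.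
by rewrite negbK; apply.
Qed.

Lemma pad_bwd' q A s S a q' : pad_delta q s = bwd i a q' ->
  prun D 1 q (facing (~~ d) A (scons s S)) w q' (facing (~~ d) (scons a A) S) w.
Proof. by rewrite /bwd le_i => qE; apply: (@run_fwd padder D (~~ d) q A s S w a None q' qE). Qed.

Lemma pad_scan q A v S : (forall b, pad_delta q (Some b) = fwd i (Some b) q) ->
  prun D (size v) q (facing d A (sapp v S)) w q (facing d (sapp (rev v) A) S) w.
Proof.
rewrite /fwd le_i => qE; have := @run_scan padder D d q (fun _ => None) v A S w qE.
by rewrite pmap_none.
Qed.

Lemma pad_scan' q A v S : (forall b, pad_delta q (Some b) = bwd i (Some b) q) ->
  prun D (size v) q (facing (~~ d) A (sapp v S)) w q (facing (~~ d) (sapp (rev v) A) S) w.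
Proof.
rewrite /bwd le_i => qE; have := @run_scan padder D (~~ d) q (fun _ => None) v A S w qE.
by rewrite pmap_none.
Qed.

(** The cell being counted is blanked as a marker while its bit is remembered in the control
    state. *)
Lemma pad_cell A b v r :
  prun D (2 * (size v + r) + 6)
    (PMark i) (facing d A (sapp (b :: v) (scons None (sapp (zs r) blank)))) w
    (PMark i) (facing d (scons (Some b) A) (sapp v (scons None (sapp (zs r.+1) blank)))) w.
Proof.
apply: (@runW _ _ (1 + (size v + (1 + (size (zs r) + (1 + (size (zs r) + (1 + (size (rev v) + 1))))))))).
  by rewrite size_rev size_nseq; lia.
apply: run_trans; first exact: (@pad_fwd _ _ _ _ None (PFar i b)).
apply: run_trans; first exact: (@pad_scan (PFar i b)).
apply: run_trans; first exact: (@pad_fwd _ _ _ _ None (PApp i b)).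
apply: run_trans; first exact: (@pad_scan (PApp i b)).
rewrite rev_zs -{1}scons_blank.
apply: run_trans; first exact: (@pad_bwd _ _ _ _ (Some false) (PRet i b)).
apply: run_trans; first exact: (@pad_scan' (PRet i b)).
apply: run_trans; first exact: (@pad_bwd' _ _ _ _ None (PUnmark i b)).
apply: run_trans; first exact: (@pad_scan' (PUnmark i b)).
rewrite revK rev_zs -sapp_rcons -[rcons (zs r) _]/(rcons (nseq r false) false) -cats1.
rewrite -[[:: false]]/(nseq 1 false) -nseqD addn1.
exact: (@pad_fwd' _ _ _ _ (Some b) (PMark i)).
Qed.

Lemma pad_word A v r :
  prun D (size v * (2 * (size v + r + size v) + 6))
    (PMark i) (facing d A (sapp v (scons None (sapp (zs r) blank)))) w
    (PMark i) (facing d (sapp (rev v) A) (scons None (sapp (zs (r + size v)) blank))) w.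
Proof.
elim: v A r => [|b v IHv] A r; first by rewrite addn0; apply: run_refl.
apply: (@runW _ _ ((2 * (size v + r) + 6) + (size v * (2 * (size v + r.+1 + size v) + 6)))).
  by rewrite /=; nia.
apply: run_trans; first exact: pad_cell.
by rewrite rev_cons sapp_rcons [size (b :: v)]/= -[r + _]addSnnS; apply: IHv.
Qed.

(** The counter still has [s] cells and [r] cells have been copied; the head looks back at the
    counter, with [U] behind it. *)
Definition block_tape U s r :=
  facing (~~ d) (scons None (sapp U (scons None (sapp (zs r) blank)))) (sapp (zs s) blank).

Lemma pad_outer U s r :
  prun D (2 * s + size U + 6 + size U * (2 * (size U + r + size U) + 6))
    (POut i) (block_tape U s.+1 r) w (POut i) (block_tape U s (r + size U)) w.
Proof.
rewrite /block_tape.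
apply: (@runW _ _ (size (zs s.+1) + (1 + (1 + (size (zs s) + (1 +
  (size U * (2 * (size U + r + size U) + 6) + (1 + (size (rev U) + 1))))))))).
  by rewrite size_rev !size_nseq; lia.
apply: run_trans; first exact: (@pad_scan' (POut i)).
rewrite rev_zs -{2}scons_blank.
apply: run_trans; first exact: (@pad_fwd' _ _ _ _ None (PTake i)).
rewrite scons_blank.
apply: run_trans; first exact: (@pad_fwd _ _ _ _ None (PThru i)).
rewrite scons_blank.
apply: run_trans; first exact: (@pad_scan (PThru i)).
apply: run_trans; first exact: (@pad_fwd _ _ _ _ None (PMark i)).
apply: run_trans; first exact: pad_word.
apply: run_trans; first exact: (@pad_bwd _ _ _ _ None (PRewind i)).
apply: run_trans; first exact: (@pad_scan' (PRewind i)).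
rewrite revK rev_zs.
exact: (@pad_bwd' _ _ _ _ None (POut i)).
Qed.

Definition block_time s l := s * (2 * s + l + 6 + l * (2 * (l + s * l + l) + 6)).

Lemma pad_outers U s r0 r : r + s * size U <= r0 * size U -> s <= r0 ->
  prun D (s * (2 * r0 + size U + 6 + size U * (2 * (size U + r0 * size U + size U) + 6)))
    (POut i) (block_tape U s r) w (POut i) (block_tape U 0 (r + s * size U)) w.
Proof.
elim: s r => [|s IHs] r le_r le_s; first by rewrite addn0; apply: run_refl.
rewrite mulSn; apply: run_trans; first apply: runW (@pad_outer U s r).
  have le_r0 : r <= r0 * size U by apply: leq_trans le_r; apply: leq_addr.
  by apply: leq_add; [lia | rewrite leq_mul2l; apply/orP; right; lia].
have -> : r + s.+1 * size U = r + size U + s * size U by rewrite mulSn addnA.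
by apply: IHs; [rewrite -addnA -mulSn | apply: ltnW].
Qed.

Lemma pad_block U s : prun D (block_time s (size U) + (size U + 2))
  (POut i) (block_tape U s 0) w
  (PCross i) (facing d (sapp (rev U) blank) (scons None (sapp (zs (s * size U)) blank))) w.
Proof.
apply: run_trans; first by have := @pad_outers U s s 0; rewrite add0n; apply.
apply: (@runW _ _ (1 + (1 + size U))); first by lia.
rewrite /block_tape /= -{2}scons_blank.
apply: run_trans; first exact: (@pad_fwd' _ _ _ _ None (PTake i)).
rewrite scons_blank.
apply: run_trans; first exact: (@pad_fwd _ _ _ _ None (PCross i)).
by rewrite scons_blank; exact: (@pad_scan (PCross i)).
Qed.

End Block.

Lemma block_time_mono s s' l : s <= s' -> block_time s l <= block_time s' l.
Proof.
move=> le_s; rewrite /block_time; apply: leq_mul => //; apply: leq_add; first by lia.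
rewrite leq_mul2l; apply/orP; right.
by rewrite leq_add2r leq_mul2l /= leq_add2r leq_add2l leq_mul2r le_s orbT.
Qed.

(** Each block multiplies the counter by [size U]. Consecutive blocks traverse the word from
    opposite ends, hence the reversal. *)
Lemma pad_blocks D w U i : i <= h.*2 -> 0 < size U ->
  prun D (i.+1 * (block_time (size U ^ h.*2.+1) (size U) + size U + 3))
    (POut 0) (block_tape 0 U 1 0) w
    (PCross i) (facing (~~ odd i) (sapp (rev (if odd i then rev U else U)) blank)
                 (scons None (sapp (zs (size U ^ i.+1)) blank))) w.
Proof.
move=> + U_gt0; elim: i => [|i IHi] le_i.
  have := @pad_block D w 0 le_i U 1; rewrite mul1n; apply: runW.
  have := @block_time_mono 1 (size U ^ h.*2.+1) (size U).
  by rewrite expn_gt0 U_gt0 => /(_ isT); lia.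
rewrite mulSn addnC; apply: run_trans (IHi (ltnW le_i)) _.
have neq_i : (i == h.*2) = false by apply: ltn_eqF.
set V := if odd i then _ else _.
have -> : (if odd i.+1 then rev U else U) = rev V by rewrite /V /=; case: (odd i); rewrite //= revK.
have sV : size V = size U by rewrite /V; case: (odd i); rewrite ?size_rev.
apply: (@runW _ _ (1 + (block_time (size U ^ i.+1) (size U) + (size U + 2)))).
  have := leq_pexp2l U_gt0 (ltnW le_i : i.+1 <= h.*2.+1).
  by move/(@block_time_mono _ _ (size U)); lia.
apply: run_trans.
  by apply: (@pad_fwd D w i (ltnW le_i) _ _ _ _ None (POut i.+1)); rewrite /= neq_i.
have := @pad_block D w i.+1 le_i (rev V) (size U ^ i.+1).
rewrite size_rev sV -expnSr /block_tape /= scons_blank negbK.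
by rewrite !negbK.
Qed.

Lemma pad_tag D x j : j <= e -> prun D j.+1 (PTag 0) (facing false (sapp x blank) blank) [::]
  (PTag j.+1) (facing false (sapp (zs j ++ true :: x) blank) blank) [::].
Proof.
have step A j' : j' <= e -> prun D 1 (PTag j') (facing false A blank) [::]
    (PTag j'.+1) (facing false (scons (Some (j' == 0)) A) blank) [::].
  move=> le_j; rewrite -{1}scons_blank.
  have := @run_fwd padder D false (PTag j') A None blank [::] (Some (j' == 0)) None (PTag j'.+1).
  by apply; rewrite /= le_j.
elim: j => [|j IHj] le_j; first exact: step.
apply: (@runW _ _ (j.+1 + 1)); first by rewrite addn1.
apply: run_trans (IHj (ltnW le_j)) _.
exact: (step (sapp (zs j ++ true :: x) blank) _ le_j).
Qed.

Definition pad_length (x : word) := (e.+1 + size x) ^ h.*2.+1.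

Definition pad_time l := e.+1 + 4 + (h.*2.+1 * (block_time (l ^ h.*2.+1) l + l + 3) + (l + 2)).

Lemma pad_run D x : exists A,
  prun D (pad_time (e.+1 + size x)) PStart (facing true blank (sapp x blank)) [::]
    PHalt (facing true A (sapp (tagged_word e x ++ zs (pad_length x)) (scons None blank))) [::].
Proof.
exists (scons None blank); set U := zs e ++ true :: x.
have sU : size U = e.+1 + size x by rewrite /U size_cat size_nseq /= addnS.
apply: (@runW _ _ (1 + (e.+1 + (1 + (1 + (h.*2.+1 * (block_time (size U ^ h.*2.+1) (size U) + size U + 3)
   + (1 + (size (rev U) + 1)))))))); first by rewrite /pad_time size_rev sU; lia.
apply: run_trans.
  have := @run_back padder D true PStart blank (sapp x blank 0) (stail (sapp x blank)) [::]
    _ None (PTag 0) erefl.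
  by rewrite scons_eta; apply.
apply: run_trans; first exact: pad_tag.
apply: run_trans.
  rewrite -{2}scons_blank.
  have := @run_fwd padder D false (PTag e.+1) (sapp U blank) None blank [::] None None PSeed.
  by apply; rewrite /= ltnn eqxx.
apply: run_trans.
  rewrite -{2}scons_blank.
  exact: (@run_stay padder D false PSeed _ _ _ _ (Some false) None (POut 0)).
apply: run_trans.
  have := @pad_blocks D [::] U h.*2 (leqnn _); rewrite sU => /(_ isT).
  by rewrite /block_tape /= scons_blank; apply.
rewrite odd_double.
(* The blank between word and counter becomes the closing [true] of [tagged_word], and the counter
   becomes the padding. *)
apply: run_trans.
  have := @pad_bwd D [::] h.*2 (leqnn _) (PCross h.*2) (sapp (rev U) blank) None
    (sapp (zs (pad_length x)) blank) (Some true) PHome.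
  by rewrite odd_double; apply; rewrite /= eqxx.
apply: run_trans; first exact: (@run_scan padder D false PHome (fun _ => None)).
rewrite revK pmap_none.
have -> : sapp (tagged_word e x ++ zs (pad_length x)) (scons None blank) =
    sapp U (scons (Some true) (sapp (zs (pad_length x)) blank)).
  rewrite scons_blank sapp_cat /tagged_word -rcons_cons -rcons_cat.
  by rewrite -/U sapp_rcons.
have := @run_back padder D false PHome
  (sapp U (scons (Some true) (sapp (zs (pad_length x)) blank))) None blank [::] None None PHalt erefl.
by rewrite !scons_blank.
Qed.

Lemma pad_delta_det q a : size (pad_delta q a) <= 1.
Proof.
by case: q => [|i||i|i|i|i|i b|i b|i b|i b|i|i|||]; case: a => [c|] //=; rewrite /fwd /bwd;
  repeat case: ifP.
Qed.

Lemma padder_det : deterministic (program padder).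
Proof. exact: (@program_deterministic padder pad_delta_det). Qed.

Lemma pad_halting t : halting (P := padder) PHalt t.
Proof. split; last by []. by move/(@code_inj padder). Qed.

Lemma padder_ptime : exists k, ptime (program padder) k.
Proof.
have pe : poly_bounded (fun n => e.+1 + n) := poly_add (poly_const _) poly_id.
have pp : poly_bounded (fun n => pad_time (e.+1 + n)).
  have pl := poly_exp h.*2.+1 pe.
  have pb := poly_mul pl (poly_add (poly_add (poly_add (poly_mul (poly_const 2) pl) pe) (poly_const 6))
    (poly_mul pe (poly_add (poly_mul (poly_const 2) (poly_add (poly_add pe (poly_mul pl pe)) pe))
      (poly_const 6)))).
  have pt := poly_add (poly_const (e.+1 + 4)) (poly_add (poly_mul (poly_const h.*2.+1)
    (poly_add (poly_add pb pe) (poly_const 3))) (poly_add pe (poly_const 2))).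
  by apply: (poly_le _ pt) => n; rewrite /pad_time /block_time; apply: leqnn.
apply: (run_ptime _ pp); first exact: pad_delta_det.
move=> D x; have [A r] := pad_run D x; do 3!eexists; split; first exact: r.
exact: pad_halting.
Qed.

Lemma padder_computes D x :
  computes D (program padder) x (tagged_word e x ++ zs (pad_length x)).
Proof. have [A r] := pad_run D x; apply: run_computes r _; exact: pad_halting. Qed.

End Padder.

Lemma pad_length_ge e k : 0 < e -> exists h, forall x, pad k x <= pad_length e h x.
Proof.
move=> e_gt0.
have [a [b Hab]] : poly_bounded (fun n => (n + (n ^ k + k) + 2) ^ 2).
  apply: poly_exp; apply: poly_add (poly_const _); apply: poly_add poly_id _.
  exact: poly_add (poly_exp _ poly_id) (poly_const _).
(* Since [e > 0] the base is at least 2, so its power [a] absorbs the coefficient [a], and its power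
   [b] the rest. *)
exists (a + b) => x; apply: leq_trans (Hab (size x)) _; rewrite /pad_length.
set l := e.+1 + size x; have l_gt1 : 1 < l by rewrite /l; lia.
apply: (@leq_trans (l ^ (a + b))); last by rewrite leq_pexp2l ?(ltnW l_gt1) // -addnn; lia.
rewrite expnD; apply: leq_mul; first by apply/ltnW/ltn_expl.
by case: (posnP b) => [->//|b_gt0]; rewrite leq_exp2r // /l; lia.
Qed.

(** * The theorem *)

Section Consequences.
Variables (Menum : nat -> machine) (O : oracle).
Notation K := (K Menum).

Definition region_language p b : language :=
  fun x => exists y, size y = size x /\ O (region p b y).

Lemma region_language_NP p b : NP O (region_language p b).
Proof.
pose c := nseq p false ++ [:: true; b].
have [k pk] := guess_ptime c; exists (program (guess c)), k; split=> // x.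
have E y : c ++ rcons y true = region p b y by rewrite /c -catA.
by rewrite guess_accepts; split=> -[y [sy Oy]]; exists y; split; rewrite // ?E // -E.
Qed.

Lemma region_languageC p x : splits O p (size x) ->
  (~ region_language p false x <-> region_language p true x).
Proof.
case=> b [[y sy Oy] nO]; split=> [nA|[y' [sy' Oy']] [y'' [sy'' Oy'']]].
  by case: b Oy {nO} => Oy; [exists y | case: nA; exists y].
by case: b {Oy} nO => nO; [apply: (nO y'') | apply: (nO y')].
Qed.

Lemma no_complete_language :
  (forall Ma ka Mb kb, ptime Ma ka -> ptime Mb kb ->
     (exists z, ~ accepts O Ma z /\ ~ accepts O Mb z) \/
     (exists p, (forall n, splits O p n) /\
        forall M k, ptime M k -> deterministic M ->
        exists n z, computes O M (nseq n false) z /\ misreduced O p n Ma Mb z)) ->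
  ~ exists C : language, NP O C /\ coNP O C /\
      forall A : language, NP O A -> coNP O A -> mreduces O A C.
Proof.
move=> diag [C [[Ma [ka [pa Ca]]] [[Mb [kb [pb Cb]]] complete]]].
have [[z [na nb]]|[p [spl mis]]] := diag _ _ _ _ pa pb.
  (* Every word lies in [C] or in its complement, so one of the two machines accepts it. *)
  by apply: nb; rewrite -Cb Ca.
have [|f [[M [k [dM [pM Mf]]]] red]] := complete _ (region_language_NP p false).
  have [M [k [pM HM]]] := region_language_NP p true.
  by exists M, k; split=> // x; rewrite region_languageC.
have [n [z [Hz [[acc nO]|[acc nO]]]]] := mis M k pM dM.
  rewrite (computes_inj dM Hz (Mf _)) -Ca -red in acc.
  by case: acc => y [sy Oy]; apply: (nO y) => //; rewrite sy size_nseq.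
rewrite (computes_inj dM Hz (Mf _)) -Cb -red region_languageC // in acc.
by case: acc => y [sy Oy]; apply: (nO y) => //; rewrite sy size_nseq.
Qed.

(** The decoder is the proof system: all codes being sound bounds its range, tag 0 makes it onto,
    and the padder for the tag of [f] translates proofs. *)
Lemma optimal_proof_system :
  (forall v m, last true v -> exists y,
     [/\ size y < m \/ y = [::], ~ K O y & codes O v m y]) ->
  (forall x m, 2 ^ size x <= m -> ~ K O x -> codes O (tagged_word 0 x) m x) ->
  (forall M k, ptime M k -> deterministic M ->
     (exists x y, computes O M x y /\ K O y) \/
     (exists2 e, 0 < e & forall x m, pad k x <= m -> exists y,
        [/\ size y < m \/ y = [::], computes O M x y & codes O (tagged_word e x) m y])) ->
  exists g, P_optimal O (coK Menum O) g.
Proof.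
move=> sound_codes slow_codes trust_codes.
have total w : {y | computes O (program decoder) w y}.
  apply: constructive_indefinite_description; have [v [m [lv ->]]] := trailing_decomp w.
  by exists (decode_bits (answers O v m m)); apply: decoder_computes.
pose g w := sval (total w).
have gE v m y : last true v -> size y < m \/ y = [::] -> codes O v m y -> g (v ++ nseq m false) = y.
  move=> lv sy Oy; rewrite -(decode_codes sy Oy).
  exact: computes_inj decoder_det (svalP (total _)) (decoder_computes _ _ lv).
exists g; split; first split.
- have [k pk] := decoder_ptime; exists (program decoder), k; split; first exact: decoder_det.
  by split=> // x; apply: svalP (total x).
- move=> y; split=> [nK|[w <- {y}]].
    exists (tagged_word 0 y ++ nseq (2 ^ size y) false).
    by apply: gE (slow_codes _ _ (leqnn _) nK); [exact: last_tagged_word | left; apply: ltn_expl].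
  have [v [m [lv ->]]] := trailing_decomp w; have [y [sy nK Oy]] := sound_codes v m lv.
  by rewrite (gE _ _ _ lv sy Oy).
move=> f [[M [k [dM [pM Mf]]]] f_range].
(* An output in [K] would contradict the range of [f], so the machine of [f] was trusted and has a
   tag. *)
have [[x [y [Hy Ky]]]|[e e_gt0 He]] := trust_codes _ _ pM dM.
  by case: ((f_range y).2 _) => //; exists x; apply: computes_inj dM (Mf x) Hy.
have [h Hh] := pad_length_ge k e_gt0.
exists (fun x => tagged_word e x ++ nseq (pad_length e h x) false); split.
  have [k' pk'] := padder_ptime e h; exists (program (padder e h)), k'.
  by split; [exact: padder_det | split=> // x; apply: padder_computes].
move=> x; have [y [sy Hy Oy]] := He x _ (Hh x).
by rewrite (gE _ _ _ (last_tagged_word _ _) sy Oy) (computes_inj dM Hy (Mf x)).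
Qed.

End Consequences.

Theorem theorem3p2 (Menum : nat -> machine) (Henum : standard_enum Menum) :
  exists O : oracle,
    (~ exists C : language, NP O C /\ coNP O C /\
         forall A : language, NP O A -> coNP O A -> mreduces O A C) /\
    (exists g : word -> word, P_optimal O (coK Menum O) g).
Proof.
have [O [sound_codes slow_codes trust_codes diag]] := generic_oracle Menum.
by exists O; split; [exact: no_complete_language | exact: optimal_proof_system].
Qed.
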